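(* Let $\mathfrak{A}$ be a $C^*$-algebra, let $E$ be a Hilbert $\mathfrak{A}$-module, let $t\in\mathcal{L}(E)$ be self-adjoint, and let $\rho$ be a state on $\mathfrak{A}$. Then for every continuous convex function $f:[-\|t\|,\|t\|]\to\mathbb{R}$ and every $x_0\in E$ satisfying $\rho(\langle x_0,x_0\rangle)=1$, we have $$f\big(\rho(\langle tx_0,x_0\rangle)\big)\leq \rho\big(\langle f(t)x_0,x_0\rangle\big).$$
   Context: Hilbert $C^*$-modules are right modules: a Hilbert $\mathfrak{A}$-module $E$ is a complex vector space and right $\mathfrak{A}$-module with an $\mathfrak{A}$-valued inner product $\langle\cdot,\cdot\rangle$ (linear in the second variable, conjugate-linear in the first, with $\langle x,ya\rangle=\langle x,y\rangle a$, $\langle x,y\rangle^*=\langle y,x\rangle$, $\langle x,x\rangle\ge 0$, and $\langle x,x\rangle=0$ only if $x=0$), complete for the norm $\|x\|=\|\langle x,x\rangle\|^{1/2}$. $\mathcal{L}(E)$ denotes the $C^*$-algebra of all adjointable operators on $E$, with unit the identity operator $I_E$. For self-adjoint $t\in\mathcal{L}(E)$, $f(t)$ is defined by the continuous functional calculus in $\mathcal{L}(E)$. The $C^*$-algebra $\mathfrak{A}$ is not assumed to be unital; a state is a positive linear functional of norm one. *)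

(* Defs.v *)
From HB Require Import structures.
From mathcomp Require Import all_boot all_order all_algebra complex.
From mathcomp Require Import all_classical all_reals all_analysis.

Set Implicit Arguments.
Unset Strict Implicit.
Unset Printing Implicit Defensive.

Import Order.TTheory GRing.Theory Num.Theory.
Import numFieldNormedType.Exports.

Local Open Scope classical_set_scope.
Local Open Scope ring_scope.
Local Open Scope complex_scope.

(* Norms of normed modules over R[i] take their values in R[i]; they are
   nonnegative, hence real, elements of R[i]. *)

(* C*-algebras, not assumed to be unital. *)
HB.mixin Record isCStarAlgebra (R : realType) (A : Type)
    of CompleteNormedModule R[i] A := {
  cmul : A -> A -> A;
  cstar : A -> A;
  cmulA : forall a b c : A, cmul a (cmul b c) = cmul (cmul a b) c;
  cmulDl : forall a b c : A, cmul (a + b) c = cmul a c + cmul b c;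
  cmulDr : forall a b c : A, cmul a (b + c) = cmul a b + cmul a c;
  cmulZl : forall (k : R[i]) (a b : A), cmul (k *: a) b = k *: cmul a b;
  cmulZr : forall (k : R[i]) (a b : A), cmul a (k *: b) = k *: cmul a b;
  norm_cmul_le : forall a b : A, `|cmul a b| <= `|a| * `|b|;
  cstarK : forall a : A, cstar (cstar a) = a;
  cstarD : forall a b : A, cstar (a + b) = cstar a + cstar b;
  cstarZ : forall (k : R[i]) (a : A), cstar (k *: a) = k^* *: cstar a;
  cstarM : forall a b : A, cstar (cmul a b) = cmul (cstar b) (cstar a);
  norm_cstar_cmul : forall a : A, `|cmul (cstar a) a| = `|a| ^+ 2
}.

#[short(type="cstarAlgType")]
HB.structure Definition CStarAlgebra (R : realType) :=
  {A of isCStarAlgebra R A & CompleteNormedModule R[i] A}.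

(* The positive elements are exactly the a^* a; this form does not need a
   unitization of A. *)
Definition cpositive (R : realType) (A : cstarAlgType R) (a : A) : Prop :=
  exists b : A, a = cmul (cstar b) b.

(* Hilbert (right) A-modules: the carrier is a Banach space whose norm is tied
   to the inner product by norm_ip, i.e. `|x| is the square root of
   `|<x, x>|. *)
HB.mixin Record isHilbertModule (R : realType) (A : cstarAlgType R) (E : Type)
    of CompleteNormedModule R[i] E := {
  ract : E -> A -> E;
  ip : E -> E -> A;
  ractDl : forall (x y : E) (a : A), ract (x + y) a = ract x a + ract y a;
  ractDr : forall (x : E) (a b : A), ract x (a + b) = ract x a + ract x b;
  ractA : forall (x : E) (a b : A), ract x (cmul a b) = ract (ract x a) b;
  ractZl : forall (k : R[i]) (x : E) (a : A), ract (k *: x) a = k *: ract x a;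
  ractZr : forall (k : R[i]) (x : E) (a : A), ract x (k *: a) = k *: ract x a;
  ipDr : forall x y z : E, ip x (y + z) = ip x y + ip x z;
  ipZr : forall (k : R[i]) (x y : E), ip x (k *: y) = k *: ip x y;
  ip_ract : forall (x y : E) (a : A), ip x (ract y a) = cmul (ip x y) a;
  cstar_ip : forall x y : E, cstar (ip x y) = ip y x;
  ip_ge0 : forall x : E, cpositive (ip x x);
  ip_eq0 : forall x : E, ip x x = 0 -> x = 0;
  norm_ip : forall x : E, `|x| ^+ 2 = `|ip x x|
}.

#[short(type="hilbertModType")]
HB.structure Definition HilbertModule (R : realType) (A : cstarAlgType R) :=
  {E of isHilbertModule R A E & CompleteNormedModule R[i] E}.

Section operators.
Variables (R : realType) (A : cstarAlgType R) (E : hilbertModType A).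
Implicit Types s t : E -> E.

Definition is_adjoint t s : Prop := forall x y : E, ip (t x) y = ip x (s y).

(* Linearity and boundedness are automatic. *)
Definition adjointable t : Prop := exists s, is_adjoint t s.

Definition selfadjoint t : Prop := adjointable t /\ is_adjoint t t.

(* The spectrum of t in the unital algebra of adjointable operators. *)
Definition spectrum t : set R[i]^o :=
  [set z : R[i] | ~ exists s, [/\ adjointable s,
     forall x, s (t x - z *: x) = x & forall x, t (s x) - z *: s x = x]].

Definition continuous_on_spectrum t (g : R[i] -> R[i]) : Prop :=
  {within spectrum t, continuous (g : R[i]^o -> R[i]^o)}.

(* Phi represents a unital *-homomorphism from C(spectrum t) to the adjointable
   operators which sends the inclusion of the spectrum in R[i] to t. An element
   of C(spectrum t) is given by any function R[i] -> R[i] extending it; the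
   values of Phi at other functions are unconstrained. *)
Record is_functional_calculus t (Phi : (R[i] -> R[i]) -> (E -> E)) : Prop := {
  fc_adjointable : forall g,
    continuous_on_spectrum t g -> adjointable (Phi g);
  fc_ext : forall g h,
    continuous_on_spectrum t g -> continuous_on_spectrum t h ->
    (forall z, spectrum t z -> g z = h z) -> Phi g = Phi h;
  fcD : forall g h,
    continuous_on_spectrum t g -> continuous_on_spectrum t h ->
    forall x, Phi (fun z => g z + h z) x = Phi g x + Phi h x;
  fcZ : forall (k : R[i]) g,
    continuous_on_spectrum t g ->
    forall x, Phi (fun z => k * g z) x = k *: Phi g x;
  fcM : forall g h,
    continuous_on_spectrum t g -> continuous_on_spectrum t h ->
    forall x, Phi (fun z => g z * h z) x = Phi g (Phi h x);
  fc_conj : forall g,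
    continuous_on_spectrum t g -> is_adjoint (Phi g) (Phi (fun z => (g z)^*));
  fc1 : forall x, Phi (fun=> 1) x = x;
  fc_id : Phi id = t
}.

(* The conditions above determine Phi on continuous functions. *)
Definition functional_calculus t : (R[i] -> R[i]) -> (E -> E) :=
  xget (fun (_ : R[i] -> R[i]) (_ : E) => 0 : E)
    [set Phi | is_functional_calculus t Phi].

(* The operator f(t), for f a real function of a real variable; the spectrum
   of a self-adjoint t is contained in [- opnorm t, opnorm t] (opnorm is defined
   below), so only the values of f on this interval matter. *)
Definition fcalc t (f : R -> R) : E -> E :=
  functional_calculus t (fun z : R[i] => (f (complex.Re z))%:C).

End operators.

(* The norm of a bounded linear map, as a real number. *)
Definition opnorm (R : realType) (V W : normedZmodType R[i]) (u : V -> W) : R :=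
  sup [set complex.Re `|u x| | x in [set x : V | `|x| <= 1]].

Definition state (R : realType) (A : cstarAlgType R) (rho : {scalar A}) : Prop :=
  (forall a : A, cpositive a -> 0 <= rho a) /\ opnorm rho = 1.

(* Main.v *)
(* A convex f dominates an affine function al + be s on [-|t|, |t|] which is
   within eps of f at m = rho <t x0, x0>, so f - (al + be s) = h^2 with h
   continuous; in the functional calculus this gives
     rho <f(t) x0, x0> - al - be m = rho <h(t) x0, h(t) x0> >= 0.

   That t has a functional calculus is obtained inside the commutative algebra
   of self-adjoint elements of the bicommutant of t. If c^2 + k^2 = M there,
   then c + i k is normal and multiplies norms by at most sqrt M, whence
   |c| <= sqrt M. Together with approximate square roots, this shows that N
   is not the norm of e as soon as N^2 - e^2 is invertible. As a real polynomial
   q without zero on the spectrum has q(t) invertible, it follows that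
   |q(t)| <= sup |q| on the spectrum, and Bernstein polynomials do the rest. *)
Require Import Defs.
From HB Require Import structures.
From mathcomp Require Import all_boot all_order all_algebra complex.
From mathcomp Require Import all_classical all_reals all_analysis.
From mathcomp Require Import ring lra.

Import Order.TTheory GRing.Theory Num.Theory.
Import numFieldNormedType.Exports.

Local Open Scope classical_set_scope.
Local Open Scope ring_scope.
Local Open Scope complex_scope.

Set Implicit Arguments.
Unset Strict Implicit.
Unset Printing Implicit Defensive.

(** [fcalc] is defined by choice, so nothing can be said of it until some functional calculus is
    shown to exist. Its construction avoids the order of operators, since it is itself a theorem
    that sums of elements b^* b have again this form: positivity is replaced by sums of two squares
    equal to a scalar up to a small error. Cauchy-Schwarz then comes with a constant 6. In the
    estimates of the calculus this 6 only multiplies errors that tend to 0, while the sharp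
    constants come from |<x, x>| = |x|^2. Polynomials in t alone would not do: the bicommutant also
    contains inverses and pointwise limits, and it stays commutative. Boundedness is not part of
    adjointability, so it has to be proved, for t and for every symmetric operator. *)

Section real_norm.
Variables (R : realType) (V : normedModType R[i]).
Implicit Types (x y : V).

(** The order of R[i] is only partial; real norms give a total order, infima and linear
    arithmetic. *)
Definition nr x : R := complex.Re `|x|.

Lemma nrE x : `|x| = (nr x)%:C.
Proof. by rewrite /nr RRe_real// normr_real. Qed.

Lemma nr_ge0 x : 0 <= nr x.
Proof. by rewrite -ler0c -nrE. Qed.

Lemma nrD x y : nr (x + y) <= nr x + nr y.
Proof. by rewrite -lecR rmorphD/= -!nrE ler_normD. Qed.

Lemma nrN x : nr (- x) = nr x.
Proof. by rewrite /nr normrN. Qed.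

Lemma nrB x y : nr (x - y) <= nr x + nr y.
Proof. by rewrite -(nrN y) nrD. Qed.

Lemma nr0 : nr 0 = 0.
Proof. by rewrite /nr normr0. Qed.

Lemma nr0_eq0 x : nr x = 0 -> x = 0.
Proof. by move=> h; apply/eqP; rewrite -normr_eq0 nrE h. Qed.

Lemma nr_gt0 x : x <> 0 -> 0 < nr x.
Proof.
move=> x0; rewrite lt_neqAle nr_ge0 andbT eq_sym.
by apply/eqP => /nr0_eq0.
Qed.

Lemma nrZ (k : R[i]) x : nr (k *: x) = complex.Re `|k| * nr x.
Proof.
apply: (@complexI R); rewrite -nrE normrZ rmorphM/= -nrE.
by rewrite (RRe_real (normr_real k)).
Qed.

Lemma nrZr (k : R) x : nr (k%:C *: x) = `|k| * nr x.
Proof. by rewrite nrZ normc_def/= expr0n addr0 sqrtr_sqr. Qed.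

Lemma nrZi x : nr ('i%C *: x) = nr x.
Proof. by rewrite nrZ normc_def/= expr0n expr1n add0r sqrtr1 mul1r. Qed.

Lemma nr_le0 x : (forall e, 0 < e -> nr x <= e) -> x = 0.
Proof.
move=> h; apply: contrapT => /nr_gt0 x0.
by have := h (nr x / 2) ltac:(lra); lra.
Qed.

End real_norm.

(** * Limits of sequences with geometrically small increments *)

Section geometric_limit.
Variables (R : realType) (V : completeNormedModType R[i]).

Lemma cvg_nr (u : nat -> V) (l : V) : u @ \oo --> l <->
  forall e : R, 0 < e -> exists N, forall n, (N <= n)%N -> nr (l - u n) <= e.
Proof.
split.
  move=> /cvgrPdist_le h e e0.
  have e0' : 0 < e%:C by rewrite ltcR.
  have [N _ hN] := h _ e0'.
  by exists N => n /hN; rewrite nrE lecR.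
move=> h; apply/cvgrPdist_le => e e0.
have eR : e = (complex.Re e)%:C by rewrite RRe_real// gtr0_real.
have [|N hN] := h (complex.Re e); first by rewrite -ltcR -eR.
by exists N => // n /hN; rewrite nrE eR lecR.
Qed.

Lemma cauchy_lim (u : nat -> V) (d : nat -> R) :
  (forall e : R, 0 < e -> exists N, forall n, (N <= n)%N -> d n <= e) ->
  (forall n m, (n <= m)%N -> nr (u m - u n) <= d n) ->
  exists l, forall n, nr (l - u n) <= d n.
Proof.
move=> d0 hd.
have : cauchy (u @ \oo).
  apply/cauchy_exP => e e0.
  have eR : e = (complex.Re e)%:C by rewrite RRe_real// gtr0_real.
  have re0 : 0 < complex.Re e by rewrite -ltcR -eR.
  have [N hN] := d0 (complex.Re e / 2) ltac:(lra).
  exists (u N); exists N => // m /= Nm.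
  rewrite -ball_normE /= distrC nrE eR ltcR.
  by have := hd _ _ Nm; have := hN _ (leqnn N); lra.
move=> /cauchy_cvg /cvg_ex[l /cvg_nr ul]; exists l => n.
apply/ler_addgt0Pr => e e0.
have [N hN] := ul e e0.
have h1 := hN (maxn N n) (leq_maxl _ _).
have h2 := hd n (maxn N n) (leq_maxr _ _).
have -> : l - u n = (l - u (maxn N n)) + (u (maxn N n) - u n).
  by rewrite addrA subrK.
apply: le_trans (nrD _ _) _; lra.
Qed.

Lemma geometric_small (C r : R) : 0 <= r < 1 ->
  forall e : R, 0 < e -> exists N, forall n, (N <= n)%N -> C * r ^+ n <= e.
Proof.
move=> /andP[r0 r1] e e0.
have /cvgr_le : (fun n => C * r ^+ n) @ \oo --> C * 0.
  by apply: cvgM; [exact: cvg_cst | apply: cvg_expr; rewrite ger0_norm].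
rewrite mulr0 => /(_ e e0)[N _ hN].
by exists N => n /hN.
Qed.

Lemma geometric_lim (u : nat -> V) (C r : R) : 0 <= C -> 0 <= r < 1 ->
  (forall n, nr (u n.+1 - u n) <= C * r ^+ n) ->
  exists l, forall n, nr (l - u n) <= C / (1 - r) * r ^+ n.
Proof.
move=> C0 hr hu; have /andP[r0 r1] := hr.
apply: cauchy_lim; first exact: geometric_small.
have K0 : 0 <= C / (1 - r) by rewrite divr_ge0//; lra.
have KE : C = C / (1 - r) * (1 - r) by rewrite divfK//; lra.
set K := C / (1 - r) in K0 KE *.
move=> n m nm.
(* The right-hand side is the geometric sum of C r^k over n <= k < m, an exact form that passes
   through the induction. *)
suff : nr (u m - u n) <= K * r ^+ n - K * r ^+ m.
  by have := mulr_ge0 K0 (exprn_ge0 m r0); lra.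
rewrite -(subnK nm) addnC; elim: (m - n)%N => [|k IH].
  by rewrite addn0 !subrr nr0.
rewrite addnS.
have -> : u (n + k).+1 - u n = (u (n + k).+1 - u (n + k)%N) + (u (n + k)%N - u n).
  by rewrite addrA subrK.
apply: le_trans (nrD _ _) _.
have := lerD (hu (n + k)%N) IH; rewrite {1}KE => /le_trans; apply.
by rewrite exprS; lra.
Qed.

End geometric_limit.

(** * Inner products and adjoints *)

Lemma conj_conjc (R : realType) (z : R[i]) : Num.conj z = conjc z.
Proof. by []. Qed.

Lemma conj_i (R : realType) : Num.conj ('i%C : R[i]) = - 'i%C.
Proof. by rewrite conj_conjc; apply/eqP; rewrite eq_complex/= oppr0 !eqxx. Qed.

Section inner_product.
Variables (R : realType) (A : cstarAlgType R) (E : hilbertModType A).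
Implicit Types (x y z : E) (s t : E -> E).

Lemma ipDl x y z : ip (x + y) z = ip x z + ip y z.
Proof. by rewrite -cstar_ip ipDr cstarD !cstar_ip. Qed.

Lemma ipZl (k : R[i]) x y : ip (k *: x) y = k^* *: ip x y.
Proof. by rewrite -cstar_ip ipZr cstarZ cstar_ip. Qed.

Lemma ipNl x y : ip (- x) y = - ip x y.
Proof. by rewrite -scaleN1r ipZl rmorphN rmorph1 scaleN1r. Qed.

Lemma ipNr x y : ip x (- y) = - ip x y.
Proof. by rewrite -scaleN1r ipZr scaleN1r. Qed.

Lemma ipBl x y z : ip (x - y) z = ip x z - ip y z.
Proof. by rewrite ipDl ipNl. Qed.

Lemma ipBr x y z : ip x (y - z) = ip x y - ip x z.
Proof. by rewrite ipDr ipNr. Qed.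

Lemma ip0l x : ip 0 x = 0.
Proof. by rewrite -(scale0r x) ipZl rmorph0 scale0r. Qed.

Lemma ip0r x : ip x 0 = 0.
Proof. by rewrite -(scale0r x) ipZr scale0r. Qed.

Lemma nr_ip x : nr (ip x x) = nr x ^+ 2.
Proof. by apply: (@complexI R); rewrite rmorphXn/= -!nrE -norm_ip. Qed.

Lemma ip_inj x y : (forall z, ip z x = ip z y) -> x = y.
Proof.
move=> h; apply/eqP; rewrite -subr_eq0; apply/eqP/ip_eq0.
by rewrite ipBr h subrr.
Qed.

Lemma nr_ipDC x y :
  nr (ip x y + ip y x) <= (nr x + nr y) ^+ 2 + nr x ^+ 2 + nr y ^+ 2.
Proof.
have -> : ip x y + ip y x = ip (x + y) (x + y) - ip x x - ip y y.
  by rewrite ipDl !ipDr addrA [RHS]addrAC addrK [RHS]addrC -addrA addKr.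
apply: le_trans (nrB _ _) _; rewrite nr_ip lerD2r.
apply: le_trans (nrB _ _) _; rewrite !nr_ip lerD2r.
by rewrite lerXn2r ?nnegrE ?addr_ge0 ?nr_ge0// nrD.
Qed.

(** Replacing y by i y turns <x, y> + <y, x> into i (<x, y> - <y, x>) and leaves the bound of
    [nr_ipDC] unchanged; <x, y> is half the sum of <x, y> + <y, x> and <x, y> - <y, x>. *)
Lemma nr_ip_le_sum x y :
  nr (ip x y) <= (nr x + nr y) ^+ 2 + nr x ^+ 2 + nr y ^+ 2.
Proof.
have h1 := nr_ipDC x y; have := nr_ipDC x ('i%C *: y).
rewrite ipZr ipZl nrZi conj_i scaleNr -scalerBr nrZi => h2.
have h3 : 2%:R%:C *: ip x y = (ip x y + ip y x) + (ip x y - ip y x).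
  by rewrite addrACA subrr addr0 -mulr2n rmorph_nat scaler_nat.
have := nrD (ip x y + ip y x) (ip x y - ip y x).
rewrite -h3 nrZr ger0_norm//; lra.
Qed.

(* A crude form of the Cauchy-Schwarz inequality, obtained by polarization;
   the optimal constant 1 would require the order of A. *)
Lemma nr_ip_le x y : nr (ip x y) <= 6 * nr x * nr y.
Proof.
have [->|/eqP/nr_gt0 x0] := eqVneq x 0; first by rewrite ip0l !nr0 mulr0 mul0r.
have [->|/eqP/nr_gt0 y0] := eqVneq y 0; first by rewrite ip0r !nr0 mulr0.
(* At unit vectors the previous bound is 2^2 + 1 + 1 = 6. *)
have := nr_ip_le_sum ((nr x)^-1%:C *: x) ((nr y)^-1%:C *: y).
rewrite ipZl ipZr conj_conjc conjc_real !nrZr !gtr0_norm ?invr_gt0// !mulVf ?gt_eqF//.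
rewrite mulrA -invfM mulrC ler_pdivrMr ?mulr_gt0//; lra.
Qed.

Lemma is_adjointC t s : is_adjoint t s -> is_adjoint s t.
Proof. by move=> ts x y; rewrite -cstar_ip -ts cstar_ip. Qed.

Lemma is_adjointD t s x y : is_adjoint t s -> t (x + y) = t x + t y.
Proof.
by move=> /is_adjointC st; apply: ip_inj => z; rewrite ipDr -!st ipDr.
Qed.

Lemma is_adjointZ t s (k : R[i]) x : is_adjoint t s -> t (k *: x) = k *: t x.
Proof.
by move=> /is_adjointC st; apply: ip_inj => z; rewrite ipZr -!st ipZr.
Qed.

End inner_product.

(** * Boundedness of symmetric operators *)

Section hellinger_toeplitz.
Variables (R : realType) (A : cstarAlgType R) (E : hilbertModType A).
Variable t : E -> E.
Hypothesis t_sa : is_adjoint t t.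

Let tZ k x : t (k *: x) = k *: t x. Proof. exact: is_adjointZ t_sa. Qed.

(** One step of a gliding hump. With u the multiple of t y of norm r, the values of <t y, .> at x +
    u and x - u differ by 2 <t y, u>, of norm 2 r |t y|, so one of the two is large enough. *)
Lemma hump (y x : E) (r : R) : 0 < r -> exists x',
  nr (x' - x) <= r /\ r * nr (t y) <= nr (ip (t y) x').
Proof.
move=> r0; have [->|/eqP/nr_gt0 ty0] := eqVneq (t y) 0.
  by exists x; rewrite subrr nr0 mulr0 nr_ge0 ltW.
pose u := (r / nr (t y))%:C *: t y.
have nu : nr u = r.
  rewrite nrZr ger0_norm ?divr_ge0 ?nr_ge0 ?ltW// divfK// gt_eqF//.
have ntu : nr (ip (t y) u) = r * nr (t y).
  rewrite ipZr nrZr nr_ip ger0_norm ?divr_ge0 ?nr_ge0 ?ltW//.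
  by rewrite expr2 mulrA divfK// gt_eqF.
have [h|h] := leP (r * nr (t y)) (nr (ip (t y) (x + u))).
  by exists (x + u); rewrite addrAC subrr add0r nu lexx.
exists (x - u); rewrite addrAC subrr add0r nrN nu lexx; split => //.
have : nr (ip (t y) u + ip (t y) u) <= nr (ip (t y) (x + u)) + nr (ip (t y) (x - u)).
  have -> : ip (t y) u + ip (t y) u = ip (t y) (x + u) - ip (t y) (x - u).
    by rewrite ipDr ipBr opprB [RHS]addrC addrA subrK.
  exact: nrB.
rewrite -mulr2n -scaler_nat -(rmorph_nat (real_complex R)) nrZr ntu ger0_norm//.
lra.
Qed.

(** If t were unbounded, humps at vectors y_n of the unit ball with |t y_n| >= 16^n n would add up
    to some l with |<t y_n, l>| of order n at least, whereas symmetry bounds it by 6 |t l|. *)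
Lemma hellinger_toeplitz : exists M, forall x, nr (t x) <= M * nr x.
Proof.
apply: contrapT => unbounded.
have big M : exists y, nr y <= 1 /\ M <= nr (t y).
  apply: contrapT => nbig; apply: unbounded; exists M => x.
  have [->|/eqP/nr_gt0 x0] := eqVneq x 0.
    have -> : t 0 = 0 by rewrite -(scale0r (0 : E)) tZ !scale0r.
    by rewrite !nr0 mulr0.
  rewrite leNgt; apply/negP => h; apply: nbig.
  exists ((nr x)^-1%:C *: x); rewrite tZ !nrZr gtr0_norm ?invr_gt0// mulVf ?gt_eqF//.
  by split => //; rewrite ler_pdivlMl// mulrC ltW.
have [y yP] := choice (fun n : nat => big (16 ^+ n * n%:R)).
(* The humps after the n-th move the limit by at most r_n / 15, which costs 6/15 of the gain r_n |t
   y|; any ratio above 7 keeps this fraction below 1. *)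
pose r n : R := (16 ^+ n.+1)^-1.
have r0 n : 0 < r n by rewrite invr_gt0 exprn_gt0.
have [g gP] := choice (fun nx : nat * E => hump (y nx.1.+1) nx.2 (r0 nx.1)).
pose x := fix x n := if n is m.+1 then g (m, x m) else 0.
have xS n : nr (x n.+1 - x n) <= 16^-1 * 16^-1 ^+ n.
  by have [+ _] := gP (n, x n); rewrite /r -exprVn exprS.
have [l lP] : exists l, forall n, nr (l - x n) <= 16^-1 / (1 - 16^-1) * 16^-1 ^+ n.
  by apply: geometric_lim => //; lra.
have tl n : n%:R <= 30 * nr (t l).
  case: n => [|n]; first by rewrite mulr_ge0// nr_ge0.
  have [_ h1] := gP (n, x n).
  have := lP n.+1; have := yP n.+1; rewrite -/(x n.+1) /= in h1 *.
  move=> [ny hy]; rewrite exprVn => hl.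
  have c0 : 0 < (16 ^+ n.+1 : R) by rewrite exprn_gt0.
  rewrite /r in h1; set c := 16 ^+ n.+1 in h1 hy hl c0.
  have h2 := nr_ip_le (t (y n.+1)) (l - x n.+1).
  have h3 := nr_ip_le (y n.+1) (t l); rewrite -t_sa in h3.
  have : nr (ip (t (y n.+1)) (x n.+1)) <=
      nr (ip (t (y n.+1)) l) + nr (ip (t (y n.+1)) (l - x n.+1)).
    by rewrite -[in leLHS](subKr l (x n.+1)) ipBr nrB.
  rewrite /= in h1 *.
  set T := nr (t (y n.+1)) in hy h1 h2 *; set W := nr (y n.+1) in ny h3 *.
  have W0 : 0 <= W by exact: nr_ge0.
  have T0 : 0 <= T by exact: nr_ge0.
  have L0 := nr_ge0 (t l).
  set D := nr (l - _) in hl h2 *; have D0 : 0 <= D by exact: nr_ge0.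
  move=> h4.
  have h5 : 6 * W * nr (t l) <= 6 * nr (t l) by rewrite ler_wpM2r//; lra.
  have h6 : 6 * T * D <= 6 * T * (15^-1 / c).
    apply: ler_wpM2l; first lra.
    have <- : 16^-1 / (1 - 16^-1) = 15^-1 :> R by field.
    by [].
  have h7 : n.+1%:R <= c^-1 * T by rewrite ler_pdivlMl// .
  lra.
have c0 : 0 <= 30 * nr (t l) by rewrite mulr_ge0// nr_ge0.
by have := archi_boundP c0; rewrite ltNge tl.
Qed.

End hellinger_toeplitz.
(* The self-adjoint part of the bicommutant of t: a commutative real algebra.
   The nonzero vector e0 is only there to make this algebra nontrivial. *)
Record bicomm (R : realType) (A : cstarAlgType R) (E : hilbertModType A)
    (t : E -> E) (t_sa : is_adjoint t t) (e0 : E) (e0_neq0 : e0 <> 0) := Bicomm {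
  bop :> E -> E;
  bop_sa : is_adjoint bop bop;
  bop_comm : forall s, is_adjoint s s -> (forall x, s (t x) = t (s x)) ->
    forall x, bop (s x) = s (bop x)
}.

(** * The bicommutant as a commutative real algebra *)

Section bicommutant.
Variables (R : realType) (A : cstarAlgType R) (E : hilbertModType A).
Variables (t : E -> E) (t_sa : is_adjoint t t) (e0 : E) (e0_neq0 : e0 <> 0).
Local Notation H := (bicomm t_sa e0_neq0).
Implicit Types (a b c : H) (x y : E) (r : R).

Lemma bicomm_ext a b : (forall x, a x = b x) -> a = b.
Proof.
case: a b => [f f1 f2] [g g1 g2] /= /funext fg; subst g.
by congr Bicomm; exact: Prop_irrelevance.
Qed.

Lemma bopD a x y : a (x + y) = a x + a y.
Proof. exact: is_adjointD (bop_sa a). Qed.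

Lemma bopZ a k x : a (k *: x) = k *: a x.
Proof. exact: is_adjointZ (bop_sa a). Qed.

Lemma bop0 a : a 0 = 0.
Proof. by rewrite -(scale0r 0) bopZ !scale0r. Qed.

Lemma bopN a x : a (- x) = - a x.
Proof. by rewrite -scaleN1r bopZ scaleN1r. Qed.

Lemma bopB a x y : a (x - y) = a x - a y.
Proof. by rewrite bopD bopN. Qed.

Lemma bop_t a x : a (t x) = t (a x).
Proof. exact: bop_comm. Qed.

(** [b] is itself a symmetric operator commuting with [t], hence one of those that [a] has to
    commute with. *)
Lemma bopC a b x : a (b x) = b (a x).
Proof. by apply: bop_comm; [exact: bop_sa | exact: bop_t]. Qed.

Definition bicomm_id : H :=
  Bicomm t_sa e0_neq0 t_sa (fun s _ st x => esym (st x)).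

Program Definition bicomm_add a b : H :=
  @Bicomm _ _ _ _ t_sa e0 e0_neq0 (fun x => a x + b x) _ _.
Next Obligation. by move=> a b x y /=; rewrite ipDl ipDr !bop_sa. Qed.
Next Obligation.
move=> a b s s_sa st x /=.
by rewrite !(bop_comm _ s_sa st) (is_adjointD _ _ s_sa).
Qed.

Program Definition bicomm_mul a b : H :=
  @Bicomm _ _ _ _ t_sa e0 e0_neq0 (fun x => a (b x)) _ _.
Next Obligation. by move=> a b x y /=; rewrite !bop_sa bopC. Qed.
Next Obligation. by move=> a b s s_sa st x /=; rewrite !(bop_comm _ s_sa st). Qed.

Program Definition bicomm_scale r a : H :=
  @Bicomm _ _ _ _ t_sa e0 e0_neq0 (fun x => r%:C *: a x) _ _.
Next Obligation.
by move=> r a x y /=; rewrite ipZl ipZr conj_conjc conjc_real bop_sa.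
Qed.
Next Obligation.
move=> r a s s_sa st x /=.
by rewrite (bop_comm _ s_sa st) (is_adjointZ _ _ s_sa).
Qed.

Program Definition bicomm_zero : H :=
  @Bicomm _ _ _ _ t_sa e0 e0_neq0 (fun=> 0) _ _.
Next Obligation. by move=> x y; rewrite ip0l ip0r. Qed.
Next Obligation.
by move=> s s_sa st x /=; rewrite -(scale0r 0) (is_adjointZ _ _ s_sa) !scale0r.
Qed.

Definition bicomm_one : H :=
  @Bicomm _ _ _ _ t_sa e0 e0_neq0 id (fun _ _ => erefl) (fun _ _ _ _ => erefl).

Definition bicomm_opp a : H := bicomm_scale (-1) a.

HB.instance Definition _ := gen_eqMixin H.
HB.instance Definition _ := gen_choiceMixin H.

Fact bicomm_addA : associative bicomm_add.
Proof. by move=> a b c; apply: bicomm_ext => x /=; rewrite addrA. Qed.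
Fact bicomm_addC : commutative bicomm_add.
Proof. by move=> a b; apply: bicomm_ext => x /=; rewrite addrC. Qed.
Fact bicomm_add0 : left_id bicomm_zero bicomm_add.
Proof. by move=> a; apply: bicomm_ext => x /=; rewrite add0r. Qed.
Fact bicomm_addN : left_inverse bicomm_zero bicomm_opp bicomm_add.
Proof.
by move=> a; apply: bicomm_ext => x /=; rewrite rmorphN rmorph1 scaleN1r addNr.
Qed.
HB.instance Definition _ := GRing.isZmodule.Build H
  bicomm_addA bicomm_addC bicomm_add0 bicomm_addN.

Fact bicomm_mulA : associative bicomm_mul.
Proof. by move=> a b c; apply: bicomm_ext. Qed.
Fact bicomm_mulC : commutative bicomm_mul.
Proof. by move=> a b; apply: bicomm_ext => x /=; rewrite bopC. Qed.
Fact bicomm_mul1 : left_id bicomm_one bicomm_mul.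
Proof. by move=> a; apply: bicomm_ext. Qed.
Fact bicomm_mulDl : left_distributive bicomm_mul bicomm_add.
Proof. by move=> a b c; apply: bicomm_ext. Qed.
Fact bicomm_one_neq0 : bicomm_one != 0.
Proof.
apply/eqP => /(congr1 (fun a : H => a e0)) /=.
by move: e0_neq0 => /[swap].
Qed.
HB.instance Definition _ := GRing.Zmodule_isComNzRing.Build H
  bicomm_mulA bicomm_mulC bicomm_mul1 bicomm_mulDl bicomm_one_neq0.

Fact bicomm_scaleA r1 r2 a :
  bicomm_scale r1 (bicomm_scale r2 a) = bicomm_scale (r1 * r2) a.
Proof. by apply: bicomm_ext => x /=; rewrite scalerA rmorphM. Qed.
Fact bicomm_scale1 : left_id 1 bicomm_scale.
Proof. by move=> a; apply: bicomm_ext => x /=; rewrite scale1r. Qed.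
Fact bicomm_scaleDr : right_distributive bicomm_scale +%R.
Proof. by move=> r a b; apply: bicomm_ext => x /=; rewrite scalerDr. Qed.
Fact bicomm_scaleDl a : {morph bicomm_scale^~ a : r1 r2 / r1 + r2}.
Proof. by move=> r1 r2; apply: bicomm_ext => x /=; rewrite rmorphD scalerDl. Qed.
HB.instance Definition _ := GRing.Zmodule_isLmodule.Build R H
  bicomm_scaleA bicomm_scale1 bicomm_scaleDr bicomm_scaleDl.

Fact bicomm_scaleAl r a b : r *: (a * b) = r *: a * b.
Proof. by apply: bicomm_ext. Qed.
HB.instance Definition _ := GRing.Lmodule_isLalgebra.Build R H bicomm_scaleAl.
HB.instance Definition _ := GRing.Lalgebra_isComAlgebra.Build R H.

Lemma bicommDE a b x : (a + b) x = a x + b x. Proof. by []. Qed.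
Lemma bicommNE a x : (- a) x = - a x.
Proof. by rewrite /= rmorphN rmorph1 scaleN1r. Qed.
Lemma bicommBE a b x : (a - b) x = a x - b x.
Proof. by rewrite bicommDE bicommNE. Qed.
Lemma bicommME a b x : (a * b) x = a (b x). Proof. by []. Qed.
Lemma bicomm1E x : (1 : H) x = x. Proof. by []. Qed.
Lemma bicomm0E x : (0 : H) x = 0. Proof. by []. Qed.
Lemma bicomm_algE r x : (r%:A : H) x = r%:C *: x. Proof. by []. Qed.

Definition bic_unit a := exists b, a * b = 1.

(** A two-sided inverse inherits symmetry and commutation from [a], so it lies in the bicommutant;
    this makes invertibility there the same as invertibility among all operators. *)
Lemma bic_unit_inv a (s : E -> E) :
  (forall x, s (a x) = x) -> (forall x, a (s x) = x) ->
  exists2 b, a * b = 1 & forall x, b x = s x.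
Proof.
move=> sa as_.
have s_sa : is_adjoint s s by move=> x y; rewrite -{1}(as_ y) -bop_sa as_.
have sC u : is_adjoint u u -> (forall x, u (t x) = t (u x)) ->
    forall x, s (u x) = u (s x).
  by move=> u_sa ut x; rewrite -{1}(as_ x) -(bop_comm _ u_sa ut) sa.
by exists (Bicomm t_sa e0_neq0 s_sa sC) => //; apply: bicomm_ext => x /=.
Qed.

Lemma bic_unitM a b : bic_unit a -> bic_unit b -> bic_unit (a * b).
Proof. by move=> [c ac] [d bd]; exists (c * d); rewrite mulrACA ac bd mulr1. Qed.

End bicommutant.

(** * Norm bounds, approximate square roots and invertibility *)

Section bounds.
Variables (R : realType) (A : cstarAlgType R) (E : hilbertModType A).
Variables (t : E -> E) (t_sa : is_adjoint t t) (e0 : E) (e0_neq0 : e0 <> 0).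
Local Notation H := (bicomm t_sa e0_neq0).
Local Notation cst := (in_alg H).
Implicit Types (a b c d e k u v : H) (x y : E) (M N r s : R).

Definition bnd a M := forall x, nr (a x) <= M * nr x.

Lemma bnd_exists a : exists2 M, 0 < M & bnd a M.
Proof.
have [M hM] := hellinger_toeplitz (bop_sa a).
exists (`|M| + 1) => [|x]; first by have := normr_ge0 M; lra.
apply: le_trans (hM x) _; apply: ler_wpM2r; first exact: nr_ge0.
by have := ler_norm M; lra.
Qed.

Lemma bnd_le a M N : M <= N -> bnd a M -> bnd a N.
Proof.
by move=> MN aM x; apply: le_trans (aM x) _; rewrite ler_wpM2r// nr_ge0.
Qed.

Lemma bndD a b M N : bnd a M -> bnd b N -> bnd (a + b) (M + N).
Proof.
by move=> aM bN x; apply: le_trans (nrD _ _) _; rewrite mulrDl lerD.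
Qed.

Lemma bndN a M : bnd a M -> bnd (- a) M.
Proof. by move=> aM x; rewrite bicommNE nrN. Qed.

Lemma bndB a b M N : bnd a M -> bnd b N -> bnd (a - b) (M + N).
Proof. by move=> aM bN; apply/bndD => //; apply: bndN. Qed.

Lemma bndM a b M N : 0 <= M -> bnd a M -> bnd b N -> bnd (a * b) (M * N).
Proof.
move=> M0 aM bN x; apply: le_trans (aM _) _.
by rewrite -mulrA ler_wpM2l.
Qed.

Lemma bnd_cst r : bnd (cst r) `|r|.
Proof. by move=> x; rewrite bicomm_algE nrZr. Qed.

Lemma bnd_cst_ge0 r : 0 <= r -> bnd (cst r) r.
Proof. by move=> r0; rewrite -{2}(ger0_norm r0); exact: bnd_cst. Qed.

Lemma bnd1 : bnd 1 1.
Proof. by move=> x; rewrite mul1r. Qed.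

Lemma bnd_cstM r a M : 0 <= r -> bnd a M -> bnd (cst r * a) (r * M).
Proof. by move=> r0; apply: bndM => //; exact: bnd_cst_ge0. Qed.

(** The Neumann series is summed at each vector, by iterating u := x + a u: the completeness used is
    that of [E], and [bic_unit_inv] brings the inverse back into the algebra. *)
Lemma neumann a r : 0 <= r < 1 -> bnd a r -> bic_unit (1 - a).
Proof.
move=> r01 ar; have /andP[r0 r1] := r01.
have solve x : exists l, (1 - a) l = x.
  pose u := fix u n := if n is m.+1 then x + a (u m) else 0.
  have uS n : nr (u n.+1 - u n) <= nr x * r ^+ n.
    elim: n => [|n IH]; first by rewrite /= bop0 addr0 subr0 mulr1.
    rewrite /= opprD addrACA subrr add0r -bopB exprS.
    by apply: le_trans (ar _) _; rewrite mulrCA ler_wpM2l.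
  have [l lP] := geometric_lim (nr_ge0 x) r01 uS.
  exists l; apply/eqP; rewrite -subr_eq0; apply/eqP/nr_le0 => e e0'.
  have [n hn] := geometric_small (nr x / (1 - r)) r01 (e := e / 2) ltac:(lra).
  have h1 := le_trans (lP n.+1) (hn _ (leqnSn n)).
  have h2 := le_trans (ar _) (ler_wpM2l r0 (le_trans (lP n) (hn _ (leqnn n)))).
  rewrite bicommBE bicomm1E.
  have -> : l - a l - x = (l - u n.+1) - a (l - u n).
    by rewrite bopB /= opprD opprB !addrA subrK addrAC.
  apply: le_trans (nrB _ _) _; nra.
have inj x : (1 - a) x = 0 -> x = 0.
  rewrite bicommBE bicomm1E => /eqP; rewrite subr_eq0 => /eqP xE.
  apply: contrapT => /nr_gt0 x0.
  by have := ar x; rewrite -xE; nra.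
have [s sP] := choice solve.
have [x|b ab _] := bic_unit_inv _ sP; last by exists b.
apply/eqP; rewrite -subr_eq0; apply/eqP/inj.
by rewrite bopB sP subrr.
Qed.

(* The iterates of y := (a + y^2) / 2 from 0 satisfy
   (1 - y_n)^2 = 1 - a + 2 (y_{n+1} - y_n). *)
Lemma sqrt_approx_lt1 a r : 0 <= r < 1 -> bnd a r ->
  forall del, 0 < del -> exists d e, d ^+ 2 = 1 - a + e /\ bnd e del.
Proof.
move=> r01 ar; have /andP[r0 r1] := r01.
pose y := fix y n : H := if n is m.+1 then cst 2^-1 * (a + y m ^+ 2) else 0.
have yr n : bnd (y n) r.
  elim: n => [|n IH] /=.
    by move=> x; rewrite bicomm0E nr0 mulr_ge0// nr_ge0.
  apply: bnd_le (bnd_cstM _ (bndD ar (bndM r0 IH IH))); nra.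
have dy n : bnd (y n.+1 - y n) (r * r ^+ n).
  elim: n => [|n IH].
    rewrite /= subr0 expr0n addr0; apply: bnd_le (bnd_cstM _ ar); lra.
  have -> : y n.+2 - y n.+1 = cst 2^-1 * ((y n.+1 + y n) * (y n.+1 - y n)).
    have yS m : y m.+1 = cst 2^-1 * (a + y m ^+ 2) by [].
    by rewrite [in LHS]yS [X in _ - X]yS; ring.
  apply: bnd_le (bnd_cstM _ (bndM _ (bndD (yr n.+1) (yr n)) IH)); try lra.
  by rewrite exprS; lra.
move=> del del0.
have [n hn] := geometric_small (2 * r) r01 del0.
exists (1 - y n), (cst 2 * (y n.+1 - y n)); split.
  have -> : y n.+1 = cst 2^-1 * (a + y n ^+ 2) by [].
  have -> : 1 - a + cst 2 * (cst 2^-1 * (a + y n ^+ 2) - y n) =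
    1 - a + cst (2 * 2^-1) * (a + y n ^+ 2) - cst 2 * y n by ring.
  by rewrite mulfV// ; ring.
by apply: bnd_le (bnd_cstM _ (dy n)) => //; rewrite mulrA; apply: hn.
Qed.

(** For r = 1 the iteration need not contract, so [a] is shrunk by the factor 1 - m and m a is moved
    into the error. *)
Lemma sqrt_approx a : bnd a 1 ->
  forall del, 0 < del -> exists d e, d ^+ 2 = 1 - a + e /\ bnd e del.
Proof.
move=> a1 del del0; pose m := Num.min del 1 / 2.
have m01 : 0 < m < 1 /\ 2 * m <= del.
  by rewrite /m; have [] := leP del 1; split; lra.
have [d [e [dE eB]]] : exists d e, d ^+ 2 = 1 - cst (1 - m) * a + e /\ bnd e m.
  apply: (@sqrt_approx_lt1 _ (1 - m)); try lra.
  by apply: bnd_le (bnd_cstM _ a1); lra.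
exists d, (e + cst m * a); split; first by rewrite dE; ring.
by apply: bnd_le (bndD eB (bnd_cstM _ a1)); lra.
Qed.

(* With u = c + i k one has u^* u = u u^* = c^2 + k^2, and c = (u + u^* ) / 2. *)
Lemma sum_squares_bound c k e M eta : c ^+ 2 + k ^+ 2 = cst M + e -> bnd e eta ->
  0 <= M -> forall x, nr (c x) ^+ 2 <= (M + 6 * eta) * nr x ^+ 2.
Proof.
move=> ck eB M0 x.
have key (z : R[i]) : Num.conj z = - z -> z * z = -1 ->
    nr (c x + z *: k x) ^+ 2 <= (M + 6 * eta) * nr x ^+ 2.
  move=> zJ zz; rewrite -nr_ip.
  have -> : ip (c x + z *: k x) (c x + z *: k x) = ip x ((c ^+ 2 + k ^+ 2) x).
    rewrite !ipDl !ipDr !ipZl !ipZr zJ scalerA mulNr zz opprK scale1r scaleNr.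
    rewrite !bop_sa (bopC k c) !expr2 !bicommME.
    by rewrite -addrA addNKr.
  rewrite ck bicommDE bicomm_algE ipDr ipZr.
  apply: le_trans (nrD _ _) _; rewrite nrZr nr_ip mulrDl ger0_norm// lerD2l.
  apply: le_trans (nr_ip_le _ _) _.
  by have := ler_wpM2l (nr_ge0 x) (eB x); lra.
have h1 := key 'i%C _ _; have h2 := key (- 'i%C) _ _.
have i2 : 'i%C * 'i%C = -1 :> R[i] by rewrite -sqr_i expr2.
have {}h1 := h1 (conj_i R) i2.
have {}h2 : nr (c x + - 'i%C *: k x) ^+ 2 <= (M + 6 * eta) * nr x ^+ 2.
  by apply: h2; rewrite ?rmorphN/= ?conj_i// mulrNN.
have := nrD (c x + 'i%C *: k x) (c x + - 'i%C *: k x).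
have -> : (c x + 'i%C *: k x) + (c x + - 'i%C *: k x) = (2%:R : R)%:C *: c x.
  by rewrite addrACA scaleNr subrr addr0 -mulr2n rmorph_nat scaler_nat.
rewrite nrZr ger0_norm//.
move: h1 h2; set p := nr (_ + _); set q := nr (_ + _); set Q := _ * nr x ^+ 2.
have := nr_ge0 (c x); set w := nr (c x) => w0 hp hq hw.
have w2 : (2 * w) ^+ 2 <= (p + q) ^+ 2 by rewrite lerXn2r// ?nnegrE; lra.
have := sqr_ge0 (p - q); nra.
Qed.

(** As the error tends to 0, the factor 6 in front of it disappears and the sharp bound remains. *)
Lemma sum_squares_bnd c M : 0 <= M ->
  (forall eta, 0 < eta ->
    exists k e, c ^+ 2 + k ^+ 2 = cst (M ^+ 2) + e /\ bnd e eta) -> bnd c M.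
Proof.
move=> M0 h x.
rewrite -(@ler_pXn2r _ 2)// ?nnegrE ?mulr_ge0 ?nr_ge0//.
have [->|/eqP/nr_gt0 x0] := eqVneq x 0; first by rewrite bop0 nr0 mulr0.
have x2 : 0 < nr x ^+ 2 by rewrite exprn_gt0.
apply/ler_addgt0Pr => del del0.
have eta0 : 0 < del / (6 * nr x ^+ 2) by rewrite divr_gt0//; lra.
have [k [e [ck eB]]] := h _ eta0.
apply: le_trans (sum_squares_bound ck eB _ x) _; first by rewrite exprn_ge0.
rewrite mulrDl exprMn lerD2l.
have -> // : 6 * (del / (6 * nr x ^+ 2)) * nr x ^+ 2 = del.
by field; rewrite gt_eqF.
Qed.

(** The identity (1 - c^2)^2 + 2 c^2 (1 - c^2 / 2) = 1 becomes a sum of two squares, since 1 - c^2 /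
    2 is approximately a square d^2; the second square is that of sqrt(2) c d. *)
Lemma bnd_1Bsqr c : bnd c 1 -> bnd (1 - c ^+ 2) 1.
Proof.
move=> c1; have c2 : bnd (c ^+ 2) 1 by rewrite -(mulr1 1); exact: bndM.
apply: sum_squares_bnd => // eta eta0.
have [d [e [dE eB]]] : exists d e, d ^+ 2 = 1 - cst 2^-1 * c ^+ 2 + e /\ bnd e (eta / 2).
  by apply: sqrt_approx; [apply: bnd_le (bnd_cstM _ c2) | ]; lra.
exists (cst (Num.sqrt 2) * (c * d)), (cst 2 * (c ^+ 2 * e)); split; last first.
  by apply: bnd_le (bnd_cstM _ (bndM _ c2 eB)); lra.
rewrite !exprMn dE -(rmorphXn cst) sqr_sqrtr//.
have -> : cst 2 * (c ^+ 2 * (1 - cst 2^-1 * c ^+ 2 + e)) =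
  cst 2 * c ^+ 2 - cst (2 * 2^-1) * (c ^+ 2) ^+ 2 + cst 2 * (c ^+ 2 * e) by ring.
by rewrite mulfV//; ring.
Qed.

(** With K = N^2 and c = N c1, 1 + c^2 = (1 + K) (1 - K / (1 + K) (1 - c1^2)), and by [bnd_1Bsqr]
    the term subtracted from 1 has norm at most K / (1 + K) < 1. *)
Lemma bic_unit_1Dsqr c : bic_unit (1 + c ^+ 2).
Proof.
have [N N0 cN] := bnd_exists c.
pose c1 := cst N^-1 * c.
have c11 : bnd c1 1.
  by apply: bnd_le (bnd_cstM _ cN); rewrite ?invr_ge0 ?mulVf ?gt_eqF// ltW.
pose K := N ^+ 2; have K0 : 0 < K by rewrite exprn_gt0.
have u1 : bic_unit (1 - cst (K / (1 + K)) * (1 - c1 ^+ 2)).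
  apply: (@neumann _ (K / (1 + K))).
    by rewrite divr_ge0 ?ltr_pdivrMr; lra.
  by rewrite -[X in bnd _ X]mulr1; apply: bnd_cstM (bnd_1Bsqr c11); rewrite divr_ge0; lra.
have -> : 1 + c ^+ 2 = (1 - cst (K / (1 + K)) * (1 - c1 ^+ 2)) * cst (1 + K).
  have -> : (1 - cst (K / (1 + K)) * (1 - c1 ^+ 2)) * cst (1 + K) =
    cst (1 + K) - cst (K / (1 + K) * (1 + K)) + cst (K / (1 + K) * (1 + K) * N^-1 * N^-1) * c ^+ 2.
    by rewrite /c1; ring.
  rewrite divfK; last by rewrite gt_eqF//; lra.
  rewrite /K expr2 mulfK ?gt_eqF// mulfV ?gt_eqF//; ring.
apply: bic_unitM u1 _; exists (cst (1 + K)^-1).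
by rewrite -rmorphM mulfV ?rmorph1// gt_eqF//; lra.
Qed.

Lemma bic_unit_cst r : r != 0 -> bic_unit (cst r).
Proof. by move=> r0; exists (cst r^-1); rewrite -rmorphM mulfV// rmorph1. Qed.

(* If v inverts 1 - (e/N)^2 and eps = 1 / (2 |v|), then
   1 - eps - (e/N)^2 = (1 - (e/N)^2) (1 - eps v) is approximately a square. *)
Lemma bnd_improve e N : 0 < N -> bnd e N -> bic_unit (cst (N ^+ 2) - e ^+ 2) ->
  exists2 N', 0 <= N' < N & bnd e N'.
Proof.
move=> N0 eN [w ew].
pose e1 := cst N^-1 * e; pose v := cst (N ^+ 2) * w.
have e11 : bnd e1 1.
  by apply: bnd_le (bnd_cstM _ eN); rewrite ?invr_ge0 ?mulVf ?gt_eqF// ltW.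
have e12 : bnd (e1 ^+ 2) 1 by rewrite -(mulr1 1); exact: bndM.
have NN : N^-1 * N^-1 * N ^+ 2 = 1 by rewrite -invfM -expr2 mulVf// gt_eqF ?exprn_gt0.
have e1v : (1 - e1 ^+ 2) * v = 1.
  have -> : (1 - e1 ^+ 2) * v = (cst (N ^+ 2) - cst (N^-1 * N^-1 * N ^+ 2) * e ^+ 2) * w.
    by rewrite /e1 /v; ring.
  by rewrite NN rmorph1 mul1r.
have [V V0 vV] := bnd_exists v.
(* The cap at 1 keeps the scalar 1 - ep of [sumE] nonnegative, as [sum_squares_bound] demands. *)
pose ep := Num.min (V^-1 / 2) 1.
have ep0 : 0 < ep by rewrite lt_min ltr01 andbT divr_gt0// invr_gt0.
have ep1 : ep <= 1 by rewrite ge_min lexx orbT.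
have epV : ep * V <= 2^-1.
  by rewrite -ler_pdivlMr// mulrC ge_min lexx.
have epv : bnd (cst ep * v) 2^-1 by apply: bnd_le (bnd_cstM _ vV) => //; exact: ltW.
(* As del <= 1, the error [n] below is bounded by 4.5 del, which [sum_squares_bound] multiplies by
   6: 27 del = ep / 2 leaves half of the gap ep. *)
pose del := ep / 54.
have del0 : 0 < del by rewrite divr_gt0.
have [d1 [n1 [d1E n1B]]] := sqrt_approx e12 del0.
have [d2 [n2 [d2E n2B]]] : exists d2 n2, d2 ^+ 2 = 1 - cst ep * v + n2 /\ bnd n2 del.
  by apply: sqrt_approx => //; apply: bnd_le epv; lra.
pose n := n1 * (1 - cst ep * v) + (1 - e1 ^+ 2) * n2 + n1 * n2.
have nB : bnd n (del * (1 + 2^-1) + (1 + 1) * del + del * del).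
  apply: bndD; last exact: bndM (ltW del0) n1B n2B.
  apply: bndD; first exact: bndM (ltW del0) n1B (bndB bnd1 epv).
  by apply: bndM => //; apply: bndB => //; exact: bnd1.
have sumE : e1 ^+ 2 + (d1 * d2) ^+ 2 = cst (1 - ep) + n.
  rewrite [(d1 * d2) ^+ 2]exprMn d1E d2E.
  have -> : (1 - e1 ^+ 2 + n1) * (1 - cst ep * v + n2) =
    1 - e1 ^+ 2 - cst ep * ((1 - e1 ^+ 2) * v) + n by rewrite /n; ring.
  by rewrite e1v; ring.
have ep'0 : 0 <= 1 - ep / 2 by lra.
exists (N * Num.sqrt (1 - ep / 2)).
  rewrite mulr_ge0 ?sqrtr_ge0 ?ltW//= gtr_pMr//.
  by rewrite -[ltRHS]sqrtr1 ltr_sqrt//; lra.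
move=> x; rewrite -(@ler_pXn2r _ 2)// ?nnegrE ?mulr_ge0 ?nr_ge0 ?sqrtr_ge0 ?(ltW N0)//.
rewrite !exprMn sqr_sqrtr//.
have := sum_squares_bound sumE nB _ x; rewrite subr_ge0 => /(_ ep1).
rewrite bicommME bicomm_algE nrZr gtr0_norm ?invr_gt0// exprMn exprVn.
rewrite ler_pdivrMl ?exprn_gt0// => /le_trans; apply.
rewrite -mulrA ler_wpM2l ?sqr_ge0//.
by rewrite ler_wpM2r ?exprn_ge0 ?nr_ge0// /del; nra.
Qed.

End bounds.

(** * The spectrum, and norms of polynomials in t *)

Section spectral_bound.
Variables (R : realType) (A : cstarAlgType R) (E : hilbertModType A).
Variables (t : E -> E) (t_sa : is_adjoint t t) (e0 : E) (e0_neq0 : e0 <> 0).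
Local Notation H := (bicomm t_sa e0_neq0).
Local Notation cst := (in_alg H).
Implicit Types (a b c d e k u v : H) (x y : E) (M N r s : R) (p q : {poly R}).

Let T : H := bicomm_id t_sa e0_neq0.
Local Notation ev := (horner_alg T).

(** Invertibility is tested at real points and inside the bicommutant; [spectrumE] shows that
    nothing is lost. *)
Definition rspec : set R := [set r | ~ bic_unit (T - cst r)].

Lemma evX : ev 'X = T. Proof. exact: horner_algX. Qed.
Lemma evC r : ev r%:P = cst r. Proof. exact: horner_algC. Qed.

Lemma ev_BXX r q : ev (r%:P - q ^+ 2) = cst r - ev q ^+ 2.
Proof. by rewrite rmorphB rmorphXn/= evC. Qed.

Lemma rspecN r : ~ rspec r -> bic_unit (T - cst r).
Proof. exact: contrapT. Qed.

Lemma bic_unit_sqrD2 a r : r != 0 -> bic_unit (a ^+ 2 + cst (r ^+ 2)).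
Proof.
move=> r0.
have -> : a ^+ 2 + cst (r ^+ 2) = cst (r ^+ 2) * (1 + (cst r^-1 * a) ^+ 2).
  have -> : cst (r ^+ 2) * (1 + (cst r^-1 * a) ^+ 2) =
    cst (r ^+ 2) + cst ((r * r^-1) ^+ 2) * a ^+ 2 by ring.
  by rewrite mulfV//; ring.
by apply: bic_unitM (bic_unit_1Dsqr _); apply: bic_unit_cst; rewrite expf_neq0.
Qed.

(** Induction on the degree, by means of a complex root z of q. A real z lies outside the spectrum,
    so X - z has an invertible value; a nonreal z = a + i b makes (X - a)^2 + b^2 divide q, and its
    value is invertible by [bic_unit_sqrD2]. *)
Lemma ev_unit q : q != 0 -> (forall r, rspec r -> q.[r] != 0) -> bic_unit (ev q).
Proof.
have [n] := ubnP (size q); elim: n q => // n IH q; rewrite ltnS => qn q0 qS.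
have IHM q1 q2 : q = q1 * q2 -> (1 < size q2)%N -> bic_unit (ev q2) -> bic_unit (ev q).
  move=> qE q2s u2; have := q0; rewrite qE mulf_eq0 negb_or => /andP[q10 q20].
  rewrite rmorphM/=; apply: bic_unitM u2; apply: IH => // [|r /qS].
    apply: leq_trans qn; rewrite qE size_mul//.
    by case: (size q2) q2s => [|[|k]]// _; rewrite !addnS /= ltnS leq_addr.
  by rewrite qE hornerM mulf_eq0 negb_or => /andP[].
have [/size1_polyC qC|q1] := leqP (size q) 1.
  by rewrite qC evC; apply: bic_unit_cst; move: q0; rewrite {1}qC polyC_eq0.
pose qc := map_poly (real_complex R) q.
have /closed_rootP[z rz] : size qc != 1 by rewrite size_map_poly neq_ltn q1 orbT.
have [b0|b0] := eqVneq (complex.Im z) 0.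
  have zE : z = (complex.Re z)%:C by rewrite [LHS]complexE b0 mulr0 addr0.
  have : root q (complex.Re z) by move: rz; rewrite zE fmorph_root.
  move=> rq; have /factor_theorem[q' qE] := rq.
  apply: IHM qE _ _; first by rewrite size_XsubC.
  rewrite rmorphB/= evX evC; apply: rspecN => /qS.
  by move: rq; rewrite /root => ->.
set a := complex.Re z; set b := complex.Im z in b0 *.
pose m : {poly R} := ('X - a%:P) ^+ 2 + (b ^+ 2)%:P.
have mE : map_poly (real_complex R) m = ('X - z%:P) * ('X - (conjc z)%:P).
  rewrite rmorphD rmorphXn/= map_polyXsubC map_polyC/=.
  have -> : ('X - z%:P) * ('X - (conjc z)%:P) =
      'X ^+ 2 - (z + conjc z)%:P * 'X + (z * conjc z)%:P :> {poly R[i]} by ring.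
  have -> : z + conjc z = a%:C + a%:C.
    by rewrite /a; case: (z) => ? ? /=; apply/eqP; rewrite eq_complex/= subrr addr0 !eqxx.
  have -> : z * conjc z = a%:C ^+ 2 + b%:C ^+ 2.
    rewrite /a /b; case: (z) => u v /=; apply/eqP.
    by rewrite eq_complex/=; apply/andP; split; apply/eqP; ring.
  by rewrite rmorphXn/=; ring.
have : m %| q.
  rewrite -(dvdp_map (real_complex R)) mE.
  have := @uniq_roots_dvdp _ qc [:: z; conjc z]; rewrite !big_cons big_nil mulr1.
  apply.
    rewrite /= rz andbT; have := complex_root_conj qc z.
    suff -> : map_poly conjc qc = qc by rewrite rz => <-.
    by rewrite /qc -map_poly_comp; apply: eq_map_poly => r; exact: conjc_real.
  rewrite uniq_rootsE /= inE andbT; apply/eqP => /(congr1 (@complex.Im R)).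
  rewrite /=; have : complex.Im (conjc z) = - b by rewrite /b; case: (z).
  by move=> -> bb; move/eqP: b0; apply; rewrite -/b in bb; lra.
move=> /dvdpP[q' qE]; apply: IHM qE _ _.
  rewrite size_polyDl ?size_exp_XsubC// size_polyC.
  by case: eqP.
rewrite rmorphD rmorphXn rmorphB/= evX !evC; exact: bic_unit_sqrD2.
Qed.

(** The infimum of the bounds is attained because each condition |a x| <= N |x| is closed in N. Its
    minimality is what [bnd_improve] contradicts. *)
Lemma least_bnd a : exists N, [/\ 0 <= N, bnd a N &
  forall N', 0 <= N' -> bnd a N' -> N <= N'].
Proof.
have [B B0 aB] := bnd_exists a.
pose P := [set N | 0 <= N /\ bnd a N].
have hP : has_inf P.
  by split; [exists B; split => //; exact: ltW | exists 0 => N []].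
exists (inf P); split.
- by apply: lb_le_inf => [|N []//]; exists B; split => //; exact: ltW.
- move=> x; apply/ler_addgt0Pr => e ep.
  have c0 : 0 < e / (nr x + 1) by rewrite divr_gt0//; have := nr_ge0 x; lra.
  have [N [N0 aN] Nlt] := inf_adherent c0 hP.
  apply: le_trans (aN x) _.
  apply: le_trans (ler_wpM2r (nr_ge0 x) (ltW Nlt)) _.
  rewrite mulrDl lerD2l mulrAC ler_pdivrMr; last by have := nr_ge0 x; lra.
  by apply: ler_wpM2l; [exact: ltW | lra].
- by move=> N' N'0 aN'; apply: ge_inf; [exists 0 => N [] | split].
Qed.

(** On an empty spectrum N^2 - X^2 has no zero, so N^2 - t^2 is invertible and the least bound N > 0
    of t could be improved; if N = 0, then t = 0 and 0 is a spectral value. *)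
Lemma rspec_neq0 : rspec !=set0.
Proof.
apply: contrapT => S0.
have [N [N0 TN Nmin]] := least_bnd T.
have [N00|Nn0] := eqVneq N 0.
  apply: S0; exists 0 => -[b]; suff -> : T - cst 0 = 0.
    by rewrite mul0r => /esym/eqP; rewrite oner_eq0.
  rewrite rmorph0 subr0; apply: bicomm_ext => x; apply: nr0_eq0.
  by apply/eqP; rewrite eq_le nr_ge0 andbT -(mul0r (nr x)) -N00; exact: TN.
have Np : 0 < N by rewrite lt_neqAle eq_sym Nn0.
have [] := bnd_improve Np TN.
  have := @ev_unit ((N ^+ 2)%:P - 'X ^+ 2).
  rewrite ev_BXX evX; apply.
    rewrite -size_poly_gt0 -opprB size_polyN size_polyDl ?size_polyXn//.
    by rewrite size_polyN size_polyC; case: eqP.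
  by move=> r Sr; case: S0; exists r.
by move=> N' /andP[N'0 N'N] /(Nmin _ N'0); rewrite leNgt N'N.
Qed.

Lemma ev_bnd q M : (forall r, rspec r -> `|q.[r]| <= M) -> bnd (ev q) M.
Proof.
move=> qM; have [r0 Sr0] := rspec_neq0.
have M0 : 0 <= M by apply: le_trans (qM _ Sr0).
have [N [N0 qN Nmin]] := least_bnd (ev q).
have [NM|MN] := leP N M; first exact: bnd_le qN.
have pos r : rspec r -> 0 < N ^+ 2 - q.[r] ^+ 2.
  move=> /qM qr; rewrite subr_gt0 -(ger0_norm (sqr_ge0 _)) normrX.
  by rewrite ltrXn2r// ?nnegrE// (le_lt_trans qr).
have [] := bnd_improve (le_lt_trans M0 MN) qN.
  have := @ev_unit ((N ^+ 2)%:P - q ^+ 2).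
  rewrite ev_BXX; apply.
    apply: contraTneq (pos _ Sr0) => q0.
    have <- : ((N ^+ 2)%:P - q ^+ 2).[r0] = N ^+ 2 - q.[r0] ^+ 2 by rewrite !hornerE.
    by rewrite q0 horner0 ltxx.
  by move=> r /pos; rewrite !hornerE => /gt_eqF ->.
by move=> N' /andP[N'0 N'N] /(Nmin _ N'0); rewrite leNgt N'N.
Qed.

Lemma rspec_le N r : 0 <= N -> bnd T N -> rspec r -> `|r| <= N.
Proof.
move=> N0 TN Sr; rewrite leNgt; apply/negP => Nr; apply: Sr.
have r0 : r != 0 by apply: contraTneq Nr => ->; rewrite normr0 -leNgt.
have -> : T - cst r = cst (- r) * (1 - cst r^-1 * T).
  have -> : cst (- r) * (1 - cst r^-1 * T) = cst (r * r^-1) * T - cst r by ring.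
  by rewrite mulfV// rmorph1 mul1r.
apply: bic_unitM; first by apply: bic_unit_cst; rewrite oppr_eq0.
apply: (@neumann _ _ _ _ _ _ _ _ (`|r|^-1 * N)).
  by rewrite mulr_ge0 ?invr_ge0//= mulrC ltr_pdivrMr ?mul1r// normr_gt0.
by apply: bndM => //; rewrite -normfV; exact: bnd_cst.
Qed.

Lemma rspec_closed : closed rspec.
Proof.
rewrite -[rspec]setCK; apply: open_closedC; rewrite openE => r /= /rspecN[w rw].
have [W W0 wW] := bnd_exists w.
apply/nbhs_ballP; exists W^-1; first by rewrite /= invr_gt0.
move=> r' /= rr'; apply.
have -> : T - cst r' = (T - cst r) * (1 - cst (r' - r) * w).
  have -> : (T - cst r) * (1 - cst (r' - r) * w) =
    T - cst r - cst (r' - r) * ((T - cst r) * w) by ring.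
  by rewrite rw; ring.
apply: bic_unitM; first by exists w.
apply: (@neumann _ _ _ _ _ _ _ _ (`|r' - r| * W)).
  by rewrite mulr_ge0 ?(ltW W0)//= -ltr_pdivlMr// mul1r distrC.
by apply: bndM => //; exact: bnd_cst.
Qed.

Lemma rspec_compact : compact rspec.
Proof.
have [N N0 TN] := bnd_exists T.
apply: subclosed_compact rspec_closed (@segment_compact _ (- N) N) _ => r.
by move=> /(rspec_le (ltW N0) TN); rewrite ler_norml /= in_itv.
Qed.

(** For z = a + i b with b <> 0 and u = t - a, the inverse of t - z is (u^2 + b^2)^-1 (u + i b),
    with adjoint (u^2 + b^2)^-1 (u - i b). At real z, [bic_unit_inv] identifies the two notions. *)
Lemma spectrumE (z : R[i]) :
  spectrum t z <-> complex.Im z = 0 /\ rspec (complex.Re z).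
Proof.
split.
- move=> Sz; have [b0|b0] := eqVneq (complex.Im z) 0.
    split => // -[w Tw]; apply: Sz; exists w.
    have Tr x : (T - cst (complex.Re z)) x = t x - z *: x.
      by rewrite bicommBE bicomm_algE [z in RHS]complexE b0 mulr0 addr0.
    split; first by exists w; exact: bop_sa.
      by move=> x; rewrite -Tr -bicommME mulrC Tw.
    by move=> x; rewrite -Tr -bicommME Tw.
  exfalso; apply: Sz.
  set a := complex.Re z; set b := complex.Im z in b0 *.
  have [u uE] : exists u, u = T - cst a by exists (T - cst a).
  have [w aw] := bic_unit_sqrD2 u b0.
  have zE : z = a%:C + 'i%C * b%:C by exact: complexE.
  have iJ : Num.conj ('i%C * b%:C : R[i]) = - ('i%C * b%:C).
    by rewrite conj_conjc; apply/eqP; rewrite eq_complex/=; apply/andP; split; apply/eqP; ring.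
  have tz x : t x - z *: x = u x - ('i%C * b%:C) *: x.
    by rewrite uE bicommBE bicomm_algE zE scalerDl opprD addrA.
  have ib2 x : ('i%C * b%:C) *: (('i%C * b%:C) *: x) = - (cst (b ^+ 2) x).
    rewrite scalerA mulrACA -expr2 sqr_i mulN1r -rmorphM -expr2 scaleNr.
    by rewrite bicomm_algE.
  have fact1 x : u (u x + ('i%C * b%:C) *: x) - ('i%C * b%:C) *: (u x + ('i%C * b%:C) *: x)
      = (u ^+ 2 + cst (b ^+ 2)) x.
    rewrite bopD bopZ scalerDr ib2 opprB addrA addrAC addrK.
    by rewrite expr2.
  exists (fun x => w (u x + ('i%C * b%:C) *: x)); split.
  - exists (fun x => w (u x - ('i%C * b%:C) *: x)) => x y.
    by rewrite bop_sa bopB bopZ ipDl ipBr ipZl ipZr iJ scaleNr bop_sa (bopC w).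
  - move=> x; rewrite tz bopB bopZ scalerBr ib2 opprK addrA addrNK.
    by rewrite -bicommME -expr2 -bicommDE -bicommME mulrC aw.
  - move=> x; rewrite tz (bopC u) -bopZ -bopB fact1.
    by rewrite -bicommME mulrC aw.
- move=> [b0 Sr] [s [_ st ts]]; apply: Sr.
  have Tr x : (T - cst (complex.Re z)) x = t x - z *: x.
    by rewrite bicommBE bicomm_algE [z in RHS]complexE b0 mulr0 addr0.
  have [||b Tb _] := @bic_unit_inv _ _ _ _ t_sa _ e0_neq0 (T - cst (complex.Re z)) s.
  - by move=> x; rewrite Tr st.
  - by move=> x; rewrite Tr ts.
  - by exists b.
Qed.

End spectral_bound.

(** * Weierstrass approximation on a compact set *)

Section polynomial_approximation.
Variable R : realType.
Implicit Types (u x y : R) (c d : nat -> R) (S : set R) (f : R -> R).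

(** De Casteljau's recursion for the sum of binomial(n, k) u^k (1 - u)^(n - k) c_k, the mean of c
    under a binomial law. *)
Fixpoint casteljau u n c : R :=
  if n is m.+1 then (1 - u) * casteljau u m c + u * casteljau u m (c \o succn)
  else c 0%N.

Fixpoint bernstein (U : {poly R}) n c : {poly R} :=
  if n is m.+1 then (1 - U) * bernstein U m c + U * bernstein U m (c \o succn)
  else (c 0%N)%:P.

Lemma horner_bernstein U n c x : (bernstein U n c).[x] = casteljau U.[x] n c.
Proof. by elim: n c => [|n IH] c /=; rewrite !hornerE// !IH. Qed.

Lemma casteljau_le u n c d : 0 <= u <= 1 -> (forall k, c k <= d k) ->
  casteljau u n c <= casteljau u n d.
Proof.
move=> /andP[u0 u1]; elim: n c d => [|n IH] c d cd //=.
have h1 := IH _ _ cd; have h2 : casteljau u n (c \o succn) <= casteljau u n (d \o succn).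
  by apply: IH => k; exact: cd.
have u1' : 0 <= 1 - u by lra.
by apply: lerD; apply: ler_wpM2l.
Qed.

(** The second moment of the binomial law about [a]: its variance plus the squared distance of its
    mean n u from [a]. The shift by [succn] moves [a], which must therefore be general. *)
Lemma casteljau_sqr u n (a al be : R) :
  casteljau u n (fun k => al + be * (k%:R - a) ^+ 2) =
  al + be * (n%:R * u * (1 - u) + (n%:R * u - a) ^+ 2).
Proof.
elim: n a => [|n IH] a /=; first by ring.
rewrite IH.
have -> : (fun k => al + be * (k%:R - a) ^+ 2) \o succn =
    (fun k => al + be * (k%:R - (a - 1)) ^+ 2).
  by apply/funext => k /=; rewrite -natr1; ring.
by rewrite IH -natr1; ring.
Qed.

(** For nearby points e suffices, and for distant ones K (x - y)^2 exceeds twice the supremum of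
    |f|. The modulus is quadratic because [casteljau_sqr] averages quadratics exactly. *)
Lemma compact_sqr_modulus S f : compact S -> {within S, continuous f} ->
  forall e, 0 < e -> exists2 K, 0 <= K &
    forall x y, S x -> S y -> `|f x - f y| <= e + K * (x - y) ^+ 2.
Proof.
move=> cS fS e e0.
have [M M0 fM] : exists2 M, 0 < M & forall x, S x -> `|f x| <= M.
  have /compact_bounded[M [_ hM]] := continuous_compact fS cS.
  exists (Num.max M 0 + 1); first by have := le_max 0 M 0; rewrite lexx orbT; lra.
  move=> x Sx; apply: (hM (Num.max M 0 + 1)); last by exists x.
  by have := le_max M M 0; rewrite lexx /=; lra.
pose P (n : nat) x := S x -> forall y, S y -> `|f x - f y| <= e + n%:R * (x - y) ^+ 2.
suff [N _ hN] : \forall n \near \oo, S `<=` P n.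
  by exists N%:R => // x y Sx Sy; exact: (hN N (leqnn N) x Sx Sx y Sy).
have /compact_near_coveringP := cS; apply => x Sx.
have /subspace_continuousP/(_ x Sx)/cvgrPdist_le/(_ (e / 2)) := fS.
have e20 : 0 < e / 2 by lra.
move=> /(_ e20)/nbhs_ballP[del /= del0 hdel].
have near1 y : S y -> `|x - y| < del -> `|f x - f y| <= e / 2.
  by move=> Sy xy; apply: hdel.
(* Points at distance at least del / 2 satisfy N (x - y)^2 >= N del^2 / 4 >= 2 M. *)
pose N := Num.bound (8 * M / del ^+ 2).
have hN : 8 * M / del ^+ 2 < N%:R.
  by apply: archi_boundP; rewrite divr_ge0 ?sqr_ge0//; lra.
exists (ball x (del / 2), [set n | (N <= n)%N]).
  by split => /=; [apply: nbhsx_ballx; lra | exists N].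
move=> [x' n] /= [xx' Nn] Sx' y Sy.
have h1 : `|x - x'| < del / 2 by exact: xx'.
have h2 := near1 x' Sx' ltac:(lra).
have [xy|xy] := ltP `|x - y| del.
  have h3 := near1 y Sy xy.
  have : `|f x' - f y| <= `|f x - f x'| + `|f x - f y|.
    by rewrite (distrC (f x)); exact: ler_distD.
  have : 0 <= n%:R * (x' - y) ^+ 2 by rewrite mulr_ge0// sqr_ge0.
  lra.
have h3 : del / 2 <= `|x' - y|.
  by have := ler_distD x' x y; lra.
have h4 : del ^+ 2 / 4 <= (x' - y) ^+ 2.
  by rewrite -[leRHS]ger0_norm ?sqr_ge0// normrX; have := normr_ge0 (x' - y); nra.
have h5 : `|f x' - f y| <= 2 * M.
  by apply: le_trans (ler_normB _ _) _; have := fM _ Sx'; have := fM _ Sy; lra.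
have h6 : 8 * M <= n%:R * del ^+ 2.
  rewrite -ler_pdivrMr ?exprn_gt0//; apply: le_trans (ltW hN) _.
  by rewrite ler_nat.
have := ler_wpM2l (ler0n R n) h4; lra.
Qed.

(** Bernstein coefficients have to be values of f at points of S, where f is controlled; each
    equidistant node is replaced by an almost nearest point of S, so f need not be extended to an
    interval. *)
Lemma near_nearest S x : S !=set0 -> forall e, 0 < e ->
  exists y, S y /\ forall z, S z -> `|y - x| <= `|z - x| + e.
Proof.
move=> S0 e e0; pose D := [set `|z - x| | z in S].
have hD : has_inf D.
  split; first by case: S0 => z Sz; exists `|z - x|, z.
  by exists 0 => _ [z _ <-].
have [_ [y Sy <-] hy] := inf_adherent e0 hD.
exists y; split=> // z Sz; apply: le_trans (ltW hy) _; rewrite lerD2r.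
by apply: ge_inf; [case: hD | exists z].
Qed.

Lemma poly_approx S f : compact S -> S !=set0 -> {within S, continuous f} ->
  forall e, 0 < e -> exists p : {poly R}, forall x, S x -> `|f x - p.[x]| <= e.
Proof.
move=> cS S0 fS e e0.
have [K K0 fK] := compact_sqr_modulus cS fS (ltac:(lra) : 0 < e / 2).
have [B B0 SB] : exists2 B, 0 < B & forall x, S x -> `|x| <= B.
  have [M [_ hM]] := compact_bounded cS.
  exists (Num.max M 0 + 1); first by have := le_max 0 M 0; rewrite lexx orbT; lra.
  move=> x Sx; apply: (hM (Num.max M 0 + 1)) => //.
  by have := le_max M M 0; rewrite lexx /=; lra.
(* Averaging al + be (k - n u)^2 gives at most e / 2 + 10 K B^2 / n, where 10 = 2 + 32 / 4 by u (1 -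
   u) <= 1/4. *)
pose n := (Num.bound (10 * K * B ^+ 2 / (e / 2))).+1.
have hn : 10 * K * B ^+ 2 / (e / 2) <= n%:R.
  apply: ltW; apply: lt_le_trans (archi_boundP _) _; last by rewrite ler_nat.
  by rewrite divr_ge0 ?mulr_ge0 ?sqr_ge0//; lra.
have n0 : 0 < (n%:R : R) by rewrite ltr0n.
have n1 : 1 <= (n%:R : R) by rewrite ler1n.
pose z (k : nat) := B * (2 * k%:R / n%:R - 1).
have eta0 : 0 < B / n%:R by rewrite divr_gt0.
have [y yP] := choice (fun k => near_nearest (z k) S0 eta0).
pose U := ((2 * B)^-1)%:P * 'X + (2^-1)%:P.
exists (bernstein U n (f \o y)) => x Sx; rewrite horner_bernstein.
set u := U.[x]; have uE : u = (2 * B)^-1 * x + 2^-1 by rewrite /u /U !hornerE.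
have xE : x = B * (2 * u - 1) by rewrite uE; field; rewrite gt_eqF.
have u01 : 0 <= u <= 1.
  have : `|B^-1 * x| <= 1.
    by rewrite normrM gtr0_norm ?invr_gt0// ler_pdivrMl// mulr1; exact: SB.
  by rewrite uE ler_norml invfM => /andP[? ?]; lra.
have /andP[u0 u1] := u01.
(* From |x - y_k| <= 2 |x - z_k| + B / n one gets (x - y_k)^2 <= 8 (x - z_k)^2 + 2 (B / n)^2, and x
   - z_k = 2 (B / n) (n u - k); hence the factors 2 and 32 = 8 * 4. *)
pose al := e / 2 + 2 * K * (B / n%:R) ^+ 2.
pose be := 32 * K * (B / n%:R) ^+ 2.
have key k : `|f x - f (y k)| <= al + be * (k%:R - n%:R * u) ^+ 2.
  have [Sy yz] := yP k; apply: le_trans (fK _ _ Sx Sy) _.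
  have xy : `|x - y k| <= 2 * `|x - z k| + B / n%:R.
    by have := ler_distD (z k) x (y k); have := yz _ Sx; rewrite (distrC (y k)); lra.
  have sq : (x - y k) ^+ 2 <= 8 * (x - z k) ^+ 2 + 2 * (B / n%:R) ^+ 2.
    rewrite -(real_normK (num_real (x - y k))) -(real_normK (num_real (x - z k))).
    have := normr_ge0 (x - y k); have := normr_ge0 (x - z k).
    move: xy; set p := `|x - y k|; set q := `|x - z k|; set h := B / n%:R.
    have := sqr_ge0 (2 * q - h) => hh xy q0 p0.
    have : p ^+ 2 <= (2 * q + h) ^+ 2 by rewrite lerXn2r// nnegrE; lra.
    nra.
  have zE : (x - z k) ^+ 2 = 4 * (B / n%:R) ^+ 2 * (k%:R - n%:R * u) ^+ 2.
    by rewrite /z xE; field; rewrite gt_eqF.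
  have := ler_wpM2l K0 sq; rewrite zE /al /be; lra.
have small : al + be * (n%:R * u * (1 - u) + (n%:R * u - n%:R * u) ^+ 2) <= e.
  rewrite subrr expr0n addr0 /al /be.
  have uu : u * (1 - u) <= 4^-1 by have := sqr_ge0 (u - 2^-1); nra.
  have nE : (B / n%:R) ^+ 2 * n%:R = B ^+ 2 / n%:R by field; rewrite gt_eqF.
  have hq : (B / n%:R) ^+ 2 <= B ^+ 2 / n%:R.
    by rewrite -nE ler_peMr// sqr_ge0.
  have hK : 10 * K * (B ^+ 2 / n%:R) <= e / 2.
    by move: hn; rewrite ler_pdivrMr; last lra; rewrite mulrA ler_pdivrMr// (mulrC (e / 2)).
  have h1 := ler_wpM2l K0 hq.
  have h2 : K * ((B / n%:R) ^+ 2 * n%:R) * (u * (1 - u)) <= K * (B ^+ 2 / n%:R) * 4^-1.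
    rewrite nE; apply: ler_wpM2l => //; rewrite mulr_ge0// divr_ge0 ?sqr_ge0//.
  lra.
have lo : casteljau u n (fun k => (f x - al) + (- be) * (k%:R - n%:R * u) ^+ 2) <=
    casteljau u n (f \o y).
  by apply: casteljau_le => // k /=; have := key k; rewrite ler_norml => /andP[? ?]; lra.
have hi : casteljau u n (f \o y) <=
    casteljau u n (fun k => (f x + al) + be * (k%:R - n%:R * u) ^+ 2).
  by apply: casteljau_le => // k /=; have := key k; rewrite ler_norml => /andP[? ?]; lra.
rewrite casteljau_sqr in lo; rewrite casteljau_sqr in hi.
by rewrite ler_norml; apply/andP; split; lra.
Qed.

End polynomial_approximation.

(** * Real continuous functions of t as limits of polynomials *)

Section continuous_calculus.
Variables (R : realType) (A : cstarAlgType R) (E : hilbertModType A).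
Variables (t : E -> E) (t_sa : is_adjoint t t) (e0 : E) (e0_neq0 : e0 <> 0).
Local Notation H := (bicomm t_sa e0_neq0).
Local Notation cst := (in_alg H).
Local Notation T := (bicomm_id t_sa e0_neq0).
Local Notation ev := (horner_alg T).
Local Notation Sp := (rspec t_sa e0_neq0).
Implicit Types (a b c : H) (x y : E) (r : R) (p q : {poly R}) (f g : R -> R).

(** This says that [a] is f(t): the same polynomials approximate f on the spectrum and [a] in norm.
    As a relation it gives the algebraic rules without fixing an approximating sequence. *)
Definition is_calc f a := forall e, 0 < e -> exists p,
  (forall r, Sp r -> `|f r - p.[r]| <= e) /\ bnd (a - ev p) e.

Lemma bnd_small_eq0 a : (forall e, 0 < e -> bnd a e) -> a = 0.
Proof.
move=> ha; apply: bicomm_ext => x; rewrite bicomm0E.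
have [->|/eqP/nr_gt0 x0] := eqVneq x 0; first exact: bop0.
apply: nr_le0 => e e0'.
have := ha (e / nr x) _ x; rewrite divr_gt0// => /(_ isT).
by rewrite divfK// gt_eqF.
Qed.

Lemma is_calc_uniq f g a b :
  (forall r, Sp r -> f r = g r) -> is_calc f a -> is_calc g b -> a = b.
Proof.
move=> fg fa gb; apply/eqP; rewrite -subr_eq0; apply/eqP/bnd_small_eq0 => e e0'.
have [p [fp ap]] := fa (e / 4) ltac:(lra).
have [q [gq bq]] := gb (e / 4) ltac:(lra).
have pq : bnd (ev (p - q)) (e / 2).
  apply: ev_bnd => r Sr; rewrite !hornerE.
  have := fp r Sr; have := gq r Sr; rewrite fg//.
  have := ler_distD (g r) p.[r] q.[r]; rewrite (distrC p.[r] (g r)); lra.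
have -> : a - b = (a - ev p) - (b - ev q) + ev (p - q).
  by rewrite rmorphB /=; ring.
by apply: bnd_le (bndD (bndB ap bq) pq); lra.
Qed.

(** By [ev_bnd] the approximating polynomials in t converge at each vector. Symmetry and commutation
    pass to the limit, the latter because the commuting operator is bounded. *)
Lemma is_calc_exists f :
  (forall e, 0 < e -> exists p, forall r, Sp r -> `|f r - p.[r]| <= e) ->
  exists a, is_calc f a.
Proof.
move=> fp.
have e0' n : 0 < (2^-1 ^+ n : R) by rewrite exprn_gt0.
have [p pP] := choice (fun n => fp _ (e0' n)).
have dp n : bnd (ev (p n.+1) - ev (p n)) (2 * 2^-1 ^+ n).
  rewrite -rmorphB; apply: ev_bnd => r Sr; rewrite !hornerE.
  have := pP n r Sr; have := pP n.+1 r Sr; rewrite exprS.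
  have := ler_distD (f r) (p n.+1).[r] (p n).[r]; rewrite (distrC _ (f r)).
  have := e0' n; lra.
have lim x : exists l, forall n, nr (l - ev (p n) x) <= 4 * nr x * 2^-1 ^+ n.
  have [|||l lP] := @geometric_lim _ _ (fun n => ev (p n) x) (2 * nr x) 2^-1.
  - by rewrite mulr_ge0// nr_ge0.
  - by lra.
  - by move=> n; rewrite -bicommBE; apply: le_trans (dp n x) _; rewrite mulrAC.
  - exists l => n; apply: le_trans (lP n) _.
    have -> // : 2 * nr x / (1 - 2^-1) = 4 * nr x by field.
have [l lP] := choice lim.
have small : forall C e : R, 0 < e -> exists n, C * 2^-1 ^+ n <= e.
  move=> C e e0''; have [|n hn] := @geometric_small _ C 2^-1 _ _ e0''; first by lra.
  by exists n; exact: hn.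
have l_sa : is_adjoint l l.
  move=> x y; apply/eqP; rewrite -subr_eq0; apply/eqP/nr_le0 => e e0''.
  (* 48 = 2 * 6 * 4: two inner products, each with the Cauchy-Schwarz constant 6 and the factor 4 of
     [lP]. *)
  have [n hn] := small (48 * nr x * nr y) _ e0''.
  have -> : ip (l x) y - ip x (l y) =
      ip (l x - ev (p n) x) y - ip x (l y - ev (p n) y).
    by rewrite ipBl ipBr bop_sa opprB addrA addrNK.
  apply: le_trans (nrB _ _) _.
  have h1 := nr_ip_le (l x - ev (p n) x) y.
  have h2 := nr_ip_le x (l y - ev (p n) y).
  have h3 := ler_wpM2r (nr_ge0 y) (lP x n).
  have h4 := ler_wpM2l (nr_ge0 x) (lP y n).
  lra.
have l_comm s : is_adjoint s s -> (forall x, s (t x) = t (s x)) ->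
    forall x, l (s x) = s (l x).
  move=> s_sa st x; apply/eqP; rewrite -subr_eq0; apply/eqP/nr_le0 => e e0''.
  have [M hM] := hellinger_toeplitz s_sa.
  have [n hn] := small (4 * nr (s x) + `|M| * (4 * nr x)) _ e0''.
  have -> : l (s x) - s (l x) = (l (s x) - ev (p n) (s x)) - s (l x - ev (p n) x).
    rewrite (bop_comm _ s_sa st) -scaleN1r (is_adjointD _ _ s_sa) -(scaleN1r (ev _ x)).
    by rewrite (is_adjointZ _ _ s_sa) !scaleN1r opprB addrA addrNK.
  apply: le_trans (nrB _ _) _.
  have h1 := lP (s x) n; have h2 := hM (l x - ev (p n) x).
  have h3 : M * nr (l x - ev (p n) x) <= `|M| * (4 * nr x * 2^-1 ^+ n).
    apply: le_trans (ler_wpM2r (nr_ge0 _) (ler_norm M)) _.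
    by apply: ler_wpM2l.
  lra.
exists (Bicomm t_sa e0_neq0 l_sa l_comm) => e e0''.
have [n hn] := small 4 _ e0''; exists (p n); split.
  by move=> r /(pP n) h; have := e0' n; lra.
move=> x; rewrite bicommBE /=; apply: le_trans (lP x n) _.
by rewrite mulrAC ler_wpM2r// nr_ge0.
Qed.

Lemma is_calc_poly p : is_calc (fun r => p.[r]) (ev p).
Proof.
move=> e e0'; exists p; split=> [r _|x]; first by rewrite subrr normr0 ltW.
by rewrite subrr bicomm0E nr0 mulr_ge0 ?nr_ge0 ?ltW.
Qed.

Lemma is_calc_cst r : is_calc (fun=> r) (cst r).
Proof. by have := is_calc_poly r%:P; rewrite evC; under eq_fun do rewrite hornerC. Qed.

Lemma is_calc_id : is_calc id T.
Proof. by have := is_calc_poly 'X; rewrite evX; under eq_fun do rewrite hornerX. Qed.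

Lemma is_calcD f g a b : is_calc f a -> is_calc g b ->
  is_calc (fun r => f r + g r) (a + b).
Proof.
move=> fa gb e e0'.
have [p [fp ap]] := fa (e / 2) ltac:(lra).
have [q [gq bq]] := gb (e / 2) ltac:(lra).
exists (p + q); split.
  move=> r Sr; rewrite hornerD opprD addrACA.
  by apply: le_trans (ler_normD _ _) _; have := fp r Sr; have := gq r Sr; lra.
have -> : a + b - ev (p + q) = (a - ev p) + (b - ev q) by rewrite rmorphD/=; ring.
by apply: bnd_le (bndD ap bq); lra.
Qed.

Lemma is_calcM f g a b M N : 
  (forall r, Sp r -> `|f r| <= M) -> (forall r, Sp r -> `|g r| <= N) ->
  is_calc f a -> is_calc g b -> is_calc (fun r => f r * g r) (a * b).
Proof.
move=> fM gN fa gb e e0'.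
have [r0 Sr0] := rspec_neq0 t_sa e0_neq0.
have M0 := le_trans (normr_ge0 _) (fM _ Sr0).
have N0 := le_trans (normr_ge0 _) (gN _ Sr0).
have [L L0 aL] := bnd_exists a.
(* Writing fg - pq = f (g - q) + (f - p) q costs at most (M + N + 1) d on the spectrum and (L + N +
   1) d for operators; d <= 1 is what bounds q by N + 1. *)
pose W := M + N + 1 + L; have W0 : 0 < W by rewrite /W; lra.
pose d := Num.min (e / W) 1.
have d0 : 0 < d by rewrite lt_min ltr01 andbT divr_gt0.
have d1 : d <= 1 by rewrite ge_min lexx orbT.
have dW : W * d <= e by rewrite mulrC -ler_pdivlMr// ge_min lexx.
have [p [fp ap]] := fa d d0; have [q [gq bq]] := gb d d0.
have qN r : Sp r -> `|q.[r]| <= N + 1.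
  move=> Sr; have := gq r Sr; have := gN r Sr.
  have := ler_normB (g r) (g r - q.[r]); rewrite subKr; lra.
exists (p * q); split.
  move=> r Sr; rewrite hornerM.
  have -> : f r * g r - p.[r] * q.[r] = f r * (g r - q.[r]) + (f r - p.[r]) * q.[r] by ring.
  apply: le_trans (ler_normD _ _) _; rewrite !normrM.
  have h1 : `|f r| * `|g r - q.[r]| <= M * d by apply: ler_pM => //; [exact: fM | exact: gq].
  have h2 : `|f r - p.[r]| * `|q.[r]| <= d * (N + 1).
    by apply: ler_pM => //; [exact: fp | exact: qN].
  have := mulr_gt0 L0 d0; rewrite /W in dW; lra.
have -> : a * b - ev (p * q) = a * (b - ev q) + (a - ev p) * ev q.
  by rewrite rmorphM/=; ring.
apply: bnd_le (bndD (bndM (ltW L0) aL bq) (bndM (ltW d0) ap (ev_bnd qN))).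
have := mulr_ge0 M0 (ltW d0); rewrite /W in dW; lra.
Qed.

Lemma is_calcZ f a r : is_calc f a -> is_calc (fun s => r * f s) (cst r * a).
Proof.
move=> fa e e0'.
have r1 : 0 < `|r| + 1 by have := normr_ge0 r; lra.
have [|p [fp ap]] := fa (e / (`|r| + 1)); first by rewrite divr_gt0.
have le_e : `|r| * (e / (`|r| + 1)) <= e.
  by rewrite mulrA ler_pdivrMr// mulrC ler_wpM2l ?ltW//; lra.
exists (r *: p); split=> [s Ss|].
  rewrite hornerZ -mulrBr normrM; apply: le_trans le_e.
  by rewrite ler_wpM2l// fp.
have -> : cst r * a - ev (r *: p) = cst r * (a - ev p).
  by rewrite linearZ/= mulrBr mulr_algl.
by apply: bnd_le le_e _; apply: bndM ap; [|exact: bnd_cst].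
Qed.

Lemma is_calcB f g a b : is_calc f a -> is_calc g b ->
  is_calc (fun r => f r - g r) (a - b).
Proof.
move=> fa /(is_calcZ (-1)) gb.
have := is_calcD fa gb; rewrite rmorphN rmorph1 mulN1r.
by under eq_fun do rewrite mulN1r.
Qed.

End continuous_calculus.

(** * Complex functions of t *)

Section functional_calculus_exists.
Variables (R : realType) (A : cstarAlgType R) (E : hilbertModType A).
Variables (t : E -> E) (t_sa : is_adjoint t t) (e0 : E) (e0_neq0 : e0 <> 0).
Local Notation H := (bicomm t_sa e0_neq0).
Local Notation cst := (in_alg H).
Local Notation T := (bicomm_id t_sa e0_neq0).
Local Notation Sp := (rspec t_sa e0_neq0).
Implicit Types (a b c : H) (x y : E) (r : R) (f : R -> R) (g h : R[i] -> R[i]).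

Definition re_part g r := complex.Re (g r%:C).
Definition im_part g r := complex.Im (g r%:C).

Definition real_calc f : H := xget 0 [set a | is_calc f a].

Lemma real_calcP f : {within Sp, continuous f} -> is_calc f (real_calc f).
Proof.
move=> fS; apply: (xgetPex (P := [set a | is_calc f a]) 0); apply: is_calc_exists.
exact: poly_approx (@rspec_compact _ _ _ _ t_sa _ e0_neq0) (rspec_neq0 t_sa e0_neq0) fS.
Qed.

Lemma real_calc_eq f a : is_calc f a -> real_calc f = a.
Proof.
move=> fa; have : is_calc f (real_calc f).
  by apply: (xgetPex (P := [set a | is_calc f a]) 0); exists a.
by move=> /is_calc_uniq; apply; [ | exact: fa].
Qed.

Lemma spectrum_rspec r : Sp r -> spectrum t r%:C.
Proof. by move=> Sr; apply/(spectrumE t_sa e0_neq0). Qed.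

Lemma norm_ReIm (z : R[i]) (e : R) : `|z| <= e%:C ->
  `|complex.Re z| <= e /\ `|complex.Im z| <= e.
Proof.
rewrite normc_def lecR => h; split; apply: le_trans h; rewrite -sqrtr_sqr.
  by rewrite ler_sqrt ?lerDl ?sqr_ge0// addr_ge0 ?sqr_ge0.
by rewrite ler_sqrt ?lerDr ?sqr_ge0// addr_ge0 ?sqr_ge0.
Qed.

Lemma continuous_on_spectrum_parts g : continuous_on_spectrum t g ->
  {within Sp, continuous (re_part g)} /\ {within Sp, continuous (im_part g)}.
Proof.
move=> gS.
have key r : Sp r -> forall e : R, 0 < e ->
    \forall r' \near within Sp (nbhs r), `|g r%:C - g r'%:C| <= e%:C.
  move=> Sr e e0'; have /subspace_continuousP/(_ _ (spectrum_rspec Sr)) := gS.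
  have ec : 0 < e%:C by rewrite ltcR.
  move=> /cvgrPdist_le/(_ _ ec)/nbhs_ballP[d /= d0 hd].
  have dE : d = (complex.Re d)%:C by rewrite RRe_real// gtr0_real.
  apply/nbhs_ballP; exists (complex.Re d); first by rewrite /= -ltcR -dE.
  move=> r' /= rr' Sr'; apply: hd; last exact: spectrum_rspec.
  by rewrite -ball_normE /= -rmorphB normc_def/= expr0n addr0 sqrtr_sqr dE ltcR.
split; apply/subspace_continuousP => r Sr; apply/cvgrPdist_le => e e0';
    have := key r Sr e e0'; apply: filterS => r' /norm_ReIm[h1 h2].
  by rewrite /re_part -raddfB.
by rewrite /im_part -raddfB.
Qed.

(** The bicommutant here holds only symmetric operators, over real scalars, so real and imaginary
    parts are treated apart. *)
Definition calc g x := real_calc (re_part g) x + 'i%C *: real_calc (im_part g) x.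

Lemma calcE g a b : is_calc (re_part g) a -> is_calc (im_part g) b ->
  calc g = fun x => a x + 'i%C *: b x.
Proof. by move=> /real_calc_eq ga /real_calc_eq gb; rewrite /calc ga gb. Qed.

(** The common bound [M], due to the compactness of the spectrum, is what [is_calcM] asks for. *)
Lemma continuous_calcP g : continuous_on_spectrum t g -> exists a b,
  [/\ is_calc (re_part g) a, is_calc (im_part g) b,
      calc g = fun x => a x + 'i%C *: b x & exists M, forall r, Sp r ->
        `|re_part g r| <= M /\ `|im_part g r| <= M].
Proof.
move=> /continuous_on_spectrum_parts[g1 g2].
exists (real_calc (re_part g)), (real_calc (im_part g)); split => //.
- exact: real_calcP.
- exact: real_calcP.
have cS := @rspec_compact _ _ _ _ t_sa _ e0_neq0.
have /compact_bounded[M1 [_ h1]] := continuous_compact g1 cS.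
have /compact_bounded[M2 [_ h2]] := continuous_compact g2 cS.
have M1m : M1 <= Num.max M1 M2 by rewrite le_max lexx.
have M2m : M2 <= Num.max M1 M2 by rewrite le_max lexx orbT.
exists (Num.max M1 M2 + 1) => r Sr; split.
  by apply: h1; [lra | exists r].
by apply: h2; [lra | exists r].
Qed.

Lemma ReM (z w : R[i]) : complex.Re (z * w) =
  complex.Re z * complex.Re w - complex.Im z * complex.Im w.
Proof. by case: z w => ? ? []. Qed.

Lemma ImM (z w : R[i]) : complex.Im (z * w) =
  complex.Re z * complex.Im w + complex.Im z * complex.Re w.
Proof. by case: z w => ? ? []. Qed.

Lemma calc_adjoint a b :
  is_adjoint (fun x => a x + 'i%C *: b x) (fun x => a x - 'i%C *: b x).
Proof. by move=> x y; rewrite ipDl ipBr ipZl ipZr !bop_sa conj_i scaleNr. Qed.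

Lemma calc_is_functional_calculus : is_functional_calculus t calc.
Proof.
split.
- move=> g /continuous_calcP[a [b [_ _ -> _]]].
  by exists (fun x => a x - 'i%C *: b x); exact: calc_adjoint.
- move=> g h /continuous_calcP[a [b [ga gb -> _]]] /continuous_calcP[c [d [hc hd -> _]]] gh.
  have -> : a = c.
    by apply: is_calc_uniq ga hc => r Sr; rewrite /re_part gh//; exact: spectrum_rspec.
  have -> // : b = d.
    by apply: is_calc_uniq gb hd => r Sr; rewrite /im_part gh//; exact: spectrum_rspec.
- move=> g h /continuous_calcP[a [b [ga gb -> _]]] /continuous_calcP[c [d [hc hd -> _]]] x.
  rewrite (@calcE _ (a + c) (b + d)).
  + by rewrite !bicommDE scalerDr addrACA.
  + by have := is_calcD ga hc; congr is_calc; apply/funext => r; rewrite /re_part raddfD.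
  + by have := is_calcD gb hd; congr is_calc; apply/funext => r; rewrite /im_part raddfD.
- move=> k g /continuous_calcP[a [b [ga gb -> _]]] x.
  set k1 := complex.Re k; set k2 := complex.Im k.
  rewrite (@calcE _ (cst k1 * a - cst k2 * b) (cst k2 * a + cst k1 * b)).
  + rewrite bicommBE bicommDE !bicommME !bicomm_algE.
    have kE : k = k1%:C + 'i%C * k2%:C by exact: complexE.
    rewrite kE scalerDl !scalerDr !scalerA -mulrA (mulrC 'i%C (_ * _)).
    rewrite -mulrA -expr2 sqr_i mulrN1 scaleNr [k1%:C * _]mulrC.
    by rewrite [_ *: a x + _ *: b x]addrC addrACA [- _ + _]addrC.
  + have := is_calcB (is_calcZ k1 ga) (is_calcZ k2 gb).
    by congr is_calc; apply/funext => r; rewrite /re_part ReM.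
  + have := is_calcD (is_calcZ k2 ga) (is_calcZ k1 gb).
    by congr is_calc; apply/funext => r; rewrite /im_part ImM addrC.
- move=> g h /continuous_calcP[a [b [ga gb -> [M hM]]]]
    /continuous_calcP[c [d [hc hd -> [N hN]]]] x.
  have M1 r Sr := (hM r Sr).1; have M2 r Sr := (hM r Sr).2.
  have N1 r Sr := (hN r Sr).1; have N2 r Sr := (hN r Sr).2.
  rewrite (@calcE _ (a * c - b * d) (a * d + b * c)).
  + rewrite bicommBE bicommDE !bicommME.
    rewrite !bopD !bopZ !scalerDr scalerA -expr2 sqr_i scaleN1r.
    by rewrite addrACA [- _ + _]addrC.
  + have := is_calcB (is_calcM M1 N1 ga hc) (is_calcM M2 N2 gb hd).
    by congr is_calc; apply/funext => r; rewrite /re_part ReM.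
  + have := is_calcD (is_calcM M1 N2 ga hd) (is_calcM M2 N1 gb hc).
    by congr is_calc; apply/funext => r; rewrite /im_part ImM.
- move=> g /continuous_calcP[a [b [ga gb -> _]]].
  rewrite (@calcE _ a (- b)).
  + move=> x y; rewrite calc_adjoint; congr ip.
    by rewrite bicommNE scalerN.
  + by move: ga; congr is_calc; apply/funext => r; rewrite /re_part; case: (g _).
  + have := is_calcZ (-1) gb; rewrite rmorphN rmorph1 mulN1r; congr is_calc.
    by apply/funext => r; rewrite /im_part mulN1r; case: (g _).
- move=> x; rewrite (@calcE _ 1 0).
  + by rewrite bicomm1E bicomm0E scaler0 addr0.
  + by rewrite -(rmorph1 cst); exact: is_calc_cst.
  + by rewrite -(rmorph0 cst); exact: is_calc_cst.
- rewrite (@calcE _ T 0).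
  + by apply/funext => x; rewrite bicomm0E scaler0 addr0.
  + exact: is_calc_id.
  + by rewrite -(rmorph0 cst); exact: is_calc_cst.
Qed.

Lemma functional_calculusP : is_functional_calculus t (functional_calculus t).
Proof.
apply: (xgetPex (P := [set Phi | is_functional_calculus t Phi])
  (fun (_ : R[i] -> R[i]) (_ : E) => 0 : E)).
by exists calc; exact: calc_is_functional_calculus.
Qed.

End functional_calculus_exists.

(** * Affine minorants of a convex function *)

Section affine_minorant.
Variable R : realType.
Implicit Types (f : R -> R) (a b m x y : R).

Lemma convex_three_points f a b x m y : convex_function `[a, b] f ->
  a <= x -> x < m -> m < y -> y <= b ->
  (y - x) * f m <= (y - m) * f x + (m - x) * f y.
Proof.
move=> fc ax xm my yb.
have yx : 0 < y - x by lra.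
have t0 : 0 <= (y - m) / (y - x) by rewrite divr_ge0; lra.
have t1 : (y - m) / (y - x) <= 1 by rewrite ler_pdivrMr; lra.
pose p := (y - m) / (y - x).
have : x \in `[a, b]%classic -> y \in `[a, b]%classic ->
  f (p * x + (1 - p) * y) <= p * f x + (1 - p) * f y := fc (Itv01 t0 t1) x y.
rewrite !inE /= !in_itv /= /p.
have -> : 1 - (y - m) / (y - x) = (m - x) / (y - x).
  by field; rewrite gt_eqF.
have -> : (y - m) / (y - x) * x + (m - x) / (y - x) * y = m.
  by field; rewrite gt_eqF.
have -> : (y - m) / (y - x) * f x + (m - x) / (y - x) * f y =
    ((y - m) * f x + (m - x) * f y) / (y - x) by field; rewrite gt_eqF.
rewrite ler_pdivlMr// mulrC; apply; lra.
Qed.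

(* At an endpoint of the interval f may have a vertical tangent, whence eps. *)
Lemma affine_minorant f a b m : {within `[a, b], continuous f} ->
  convex_function `[a, b] f -> a <= m <= b ->
  forall eps, 0 < eps -> exists be, forall s, a <= s <= b ->
    f m - eps + be * (s - m) <= f s.
Proof.
move=> fC fc /andP[am mb] eps eps0.
have [K K0 fK] := compact_sqr_modulus (@segment_compact _ a b) fC eps0.
have fm s : a <= s <= b -> f m - eps - K * (m - s) ^+ 2 <= f s.
  move=> sab; have : `|f m - f s| <= eps + K * (m - s) ^+ 2.
    by apply: fK; rewrite /= in_itv /= ?am ?mb.
  by rewrite ler_norml => /andP[_]; lra.
(* At an endpoint, (m - s)^2 <= (b - a) |s - m| and s - m has constant sign, so the parabola of [fm]
   lies above a line. *)
move: am; rewrite le_eqVlt => /predU1P[am|am].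
  exists (- (K * (b - a))) => s sab; apply: le_trans (fm s sab).
  have /andP[as_ sb] := sab.
  have : K * (m - s) ^+ 2 <= K * ((b - a) * (s - m)).
    by apply: ler_wpM2l => //; rewrite -am; nra.
  lra.
move: mb; rewrite le_eqVlt => /predU1P[mb|mb].
  exists (K * (b - a)) => s sab; apply: le_trans (fm s sab).
  have /andP[as_ sb] := sab.
  have : K * (m - s) ^+ 2 <= K * ((b - a) * (m - s)).
    by apply: ler_wpM2l => //; rewrite mb; nra.
  lra.
(* In the interior the slope is the supremum of the slopes on the left of m, which convexity bounds
   by those on the right. *)
pose D := [set (f m - f x) / (m - x) | x in [set x | a <= x < m]].
have slopes x y : a <= x < m -> m < y <= b ->
    (f m - f x) / (m - x) <= (f y - f m) / (y - m).
  move=> /andP[ax xm] /andP[my yb].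
  rewrite ler_pdivrMr ?subr_gt0// mulrAC ler_pdivlMr ?subr_gt0//.
  by have := convex_three_points fc ax xm my yb; lra.
have hD : has_sup D.
  split; first by exists ((f m - f a) / (m - a)); exists a; rewrite //= lexx.
  exists ((f b - f m) / (b - m)) => _ [x xam <-].
  by apply: slopes; rewrite // mb lexx.
exists (sup D) => s /andP[as_ sb].
have [sm|ms|->] := ltgtP s m; last by lra.
  have : (f m - f s) / (m - s) <= sup D.
    by apply: ub_le_sup; [case: hD | exists s; rewrite //= as_ sm].
  by rewrite ler_pdivrMr ?subr_gt0//; lra.
have : sup D <= (f s - f m) / (s - m).
  by apply: ge_sup => [|_ [x xam <-]]; [case: hD | apply: slopes; rewrite // ms].
by rewrite ler_pdivlMr ?subr_gt0//; lra.
Qed.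

End affine_minorant.

(** The supremum defining [opnorm t] is meaningful only for a bounded t, which [hellinger_toeplitz]
    provides. *)
Lemma opnorm_bound (R : realType) (A : cstarAlgType R) (E : hilbertModType A)
  (t : E -> E) : is_adjoint t t ->
  0 <= opnorm t /\ forall x, nr (t x) <= opnorm t * nr x.
Proof.
move=> t_sa; have [M hM] := hellinger_toeplitz t_sa.
have t0 : t 0 = 0 by rewrite -(scale0r (0 : E)) (is_adjointZ _ _ t_sa) !scale0r.
pose D := [set complex.Re `|t x| | x in [set x : E | `|x| <= 1]].
have ubD : ubound D `|M|.
  move=> _ [x /= x1 <-]; apply: le_trans (hM x) _.
  have nx1 : nr x <= 1 by rewrite -lecR -nrE.
  apply: le_trans (ler_wpM2r (nr_ge0 x) (ler_norm M)) _.
  by rewrite -[leRHS]mulr1 ler_wpM2l.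
have leD x : nr x <= 1 -> nr (t x) <= opnorm t.
  move=> x1; apply: ub_le_sup; first by exists `|M|.
  by exists x => //=; rewrite nrE lecR.
split; first by apply: le_trans (leD 0 _); rewrite ?t0 nr0.
move=> x; have [->|/eqP/nr_gt0 x0] := eqVneq x 0; first by rewrite t0 !nr0 mulr0.
have := leD ((nr x)^-1%:C *: x).
rewrite (is_adjointZ _ _ t_sa) !nrZr gtr0_norm ?invr_gt0// mulVf ?gt_eqF//.
by move=> /(_ (lexx _)); rewrite mulrC ler_pdivrMr.
Qed.

(** * The inequality for an arbitrary functional calculus of t *)

Section jensen.
Variables (R : realType) (A : cstarAlgType R) (E : hilbertModType A).
Variables (t : E -> E) (F : (R[i] -> R[i]) -> E -> E) (N : R).
Hypothesis FC : is_functional_calculus t F.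
Hypothesis spectrum_itv : forall z, spectrum t z ->
  complex.Im z = 0 /\ - N <= complex.Re z <= N.
Variables (rho : {scalar A}) (rho_state : state rho).
Implicit Types (h k : R -> R) (x : E) (z : R[i]).

(** The same extension of a real function as in [fcalc]. *)
Definition lift h z := (h (complex.Re z))%:C.

Lemma lift_continuous h : {within `[- N, N], continuous h} ->
  continuous_on_spectrum t (lift h).
Proof.
move=> hC; apply/subspace_continuousP => z Sz; apply/cvgrPdist_le => e e0.
have eE : e = (complex.Re e)%:C by rewrite RRe_real// gtr0_real.
have re0 : 0 < complex.Re e by rewrite -ltcR -eE.
have [_ zN] := spectrum_itv Sz.
have zN' : `[- N, N]%classic (complex.Re z) by rewrite /= in_itv.
have /subspace_continuousP/(_ _ zN')/cvgrPdist_le/(_ _ re0)/nbhs_ballP[d /= d0 hd] := hC.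
apply/nbhs_ballP; exists d%:C; first by rewrite /= ltcR.
move=> z' /= zz' Sz'; have [_ zN2] := spectrum_itv Sz'.
rewrite /lift -rmorphB normc_def/= expr0n addr0 sqrtr_sqr eE lecR.
apply: hd; last by rewrite /= in_itv.
rewrite /ball /= -raddfB.
move: zz'; rewrite -ball_normE /= normc_def ltcR => /le_lt_trans; apply.
by rewrite -sqrtr_sqr ler_sqrt ?lerDl ?sqr_ge0// addr_ge0 ?sqr_ge0.
Qed.

Lemma calc_ge0 h x : {within `[- N, N], continuous h} ->
  (forall s, - N <= s <= N -> 0 <= h s) -> 0 <= rho (ip (F (lift h) x) x).
Proof.
move=> hC h0; pose k s := Num.sqrt (h s).
have kC : {within `[- N, N], continuous k}.
  by move=> s; apply: continuous_comp (hC s) _; exact: sqrt_continuous.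
have kkC : {within `[- N, N], continuous (fun s => k s * k s)}.
  by move=> s; exact: cvgM (kC s) (kC s).
have liftkk : lift (fun s => k s * k s) = fun z => lift k z * lift k z.
  by apply/funext => z; rewrite /lift rmorphM.
have -> : F (lift h) = F (fun z => lift k z * lift k z).
  rewrite -liftkk; apply: (fc_ext FC); [exact: lift_continuous..|].
  move=> z /spectrum_itv[_ zN]; rewrite /lift /k -expr2 sqr_sqrtr//.
  exact: h0.
have k_sa : is_adjoint (F (lift k)) (F (lift k)).
  have := fc_conj FC (lift_continuous kC); congr is_adjoint.
  by congr F; apply/funext => z; exact: conjc_real.
rewrite (fcM FC); [|exact: lift_continuous..].
by rewrite k_sa; apply: (proj1 rho_state); exact: ip_ge0.
Qed.

Lemma lift_affine al be x :
  F (lift (fun s => al + be * s)) x = al%:C *: x + be%:C *: t x.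
Proof.
have c1 : continuous_on_spectrum t (fun=> 1) by move=> z; exact: cvg_cst.
have cid : continuous_on_spectrum t id.
  by apply/subspace_continuousP => z _; exact: cvg_within.
have cal : continuous_on_spectrum t (fun=> al%:C * 1) by move=> z; exact: cvg_cst.
have cbe : continuous_on_spectrum t (fun z => be%:C * z).
  by move=> z; apply: cvgM; [exact: cvg_cst | exact: cid].
have -> : F (lift (fun s => al + be * s)) = F (fun z => al%:C * 1 + be%:C * z).
  apply: (fc_ext FC).
  - apply: lift_continuous => s; apply: cvgD; first exact: cvg_cst.
    apply: cvgM; first exact: cvg_cst.
    by move: s; apply/subspace_continuousP => z _; exact: cvg_within.
  - by move=> z; apply: cvgD; [exact: cal | exact: cbe].
  - move=> z /spectrum_itv[z0 _]; rewrite /lift mulr1 rmorphD rmorphM/=.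
    by rewrite [z in RHS]complexE z0 mulr0 addr0.
rewrite (fcD FC cal cbe) (fcZ FC _ c1) (fcZ FC _ cid) (fc1 FC).
by rewrite (fc_id FC).
Qed.

Lemma jensen_calc f x : {within `[- N, N], continuous f} ->
  convex_function `[- N, N] f -> rho (ip x x) = 1 ->
  (f (complex.Re (rho (ip (t x) x))))%:C <= rho (ip (F (lift f) x) x).
Proof.
move=> fC fc x1.
have aC al be : {within `[- N, N], continuous (fun s => al + be * s)}.
  move=> s; apply: cvgD; first exact: cvg_cst.
  apply: cvgM; first exact: cvg_cst.
  by move: s; apply/subspace_continuousP => z _; exact: cvg_within.
set w := rho _.
have rho_affine al be :
    rho (ip (F (lift (fun s => al + be * s)) x) x) = al%:C + be%:C * w.
  rewrite lift_affine ipDl !ipZl !conj_conjc !conjc_real raddfD /= !linearZ /=.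
  by rewrite x1 mulr1.
(* The functions N + s and N - s are nonnegative on the interval. In the order of R[i] the resulting
   inequalities also make w real. *)
have lo : (- N)%:C <= w.
  have := calc_ge0 x (aC N 1); rewrite rho_affine rmorph1 mul1r => wN.
  rewrite -subr_ge0 rmorphN opprK addrC; apply: wN => s /andP[]; lra.
have hi : w <= N%:C.
  have := calc_ge0 x (aC N (-1)); rewrite rho_affine rmorphN rmorph1 mulN1r => wN.
  rewrite -subr_ge0; apply: wN => s /andP[]; lra.
have affine_le al be : (forall s, - N <= s <= N -> al + be * s <= f s) ->
    al%:C + be%:C * w <= rho (ip (F (lift f) x) x).
  move=> fle.
  have dC : {within `[- N, N], continuous (fun s => f s - (al + be * s))}.
    by move=> s; apply: cvgB; [exact: fC | exact: aC].
  have := calc_ge0 x dC.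
  have -> : F (lift f) x = F (lift (fun s => f s - (al + be * s))) x
      + F (lift (fun s => al + be * s)) x.
    rewrite -(fcD FC (lift_continuous dC) (lift_continuous (aC al be))).
    by congr (F _ x); apply/funext => z; rewrite /lift -rmorphD subrK.
  rewrite ipDl raddfD /= rho_affine lerDr; apply => s sN.
  by rewrite subr_ge0; exact: fle.
have [wI wN] : complex.Im w = 0 /\ - N <= complex.Re w <= N.
  by move: hi lo; rewrite !lecE/= => /andP[/eqP <- ->] /andP[_ ->].
have wE : w = (complex.Re w)%:C by rewrite [LHS]complexE wI mulr0 addr0.
have key eps : 0 < eps -> (f (complex.Re w) - eps)%:C <= rho (ip (F (lift f) x) x).
  move=> eps0; have [be hbe] := affine_minorant fC fc wN eps0.
  have := affine_le (f (complex.Re w) - eps - be * complex.Re w) be.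
  rewrite [X in be%:C * X]wE -rmorphM -rmorphD addrNK; apply => s sN.
  by have := hbe s sN; lra.
(* The instance eps = 1 serves to show that the right-hand side is real; eps then tends to 0 among
   reals. *)
have := key 1 ltr01; rewrite !lecE /= => /andP[-> _] /=.
apply/ler_addgt0Pr => eps /key; rewrite lecE /= => /andP[_]; lra.
Qed.

End jensen.

Unset Implicit Arguments.

(* rho <t x0, x0> is real since t is self-adjoint, whence the real part on the
   left. The order is that of R[i], so the right-hand side is also asserted to
   be real. *)
Theorem theorem3p1 (R : realType) (A : cstarAlgType R) (E : hilbertModType A)
  (t : E -> E) (ht : selfadjoint t)
  (rho : {scalar A}) (hrho : state rho)
  (f : R -> R)
  (f_cont : {within `[- opnorm t, opnorm t], continuous f})
  (f_convex : convex_function `[- opnorm t, opnorm t] f)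
  (x0 : E) (hx0 : rho (ip x0 x0) = 1) :
  (f (complex.Re (rho (ip (t x0) x0))))%:C <= rho (ip (fcalc t f x0) x0).
Proof.
have t_sa := proj2 ht.
(* [x0] itself is the nonzero vector that makes the bicommutant nontrivial. *)
have x0_neq0 : x0 <> 0.
  move=> x00; move: hx0; rewrite x00 ip0l raddf0 => /esym/eqP.
  by rewrite oner_eq0.
have [N0 tN] := opnorm_bound t_sa.
apply: (@jensen_calc _ _ _ t (functional_calculus t) (opnorm t) _ _ rho hrho) => //.
  exact (functional_calculusP t_sa x0_neq0).
move=> z /(spectrumE t_sa x0_neq0)[z0 Sz]; split => //.
by rewrite -ler_norml; exact: (rspec_le (t_sa := t_sa) (e0_neq0 := x0_neq0)) Sz.
Qed.
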